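(* Let $\mathfrak{r}\in\mathcal{R}$ be of genus $g$, and let $\mathring{n}_2(\mathfrak{r})$ be the number of vertices of interior degree $4$ of $\mathfrak{r}$. Then $$O^\times_{\overline{\mathfrak{r}}}(z_\bullet,z_\circ)=\frac{R_{\overline{\mathfrak{r}}}(T_\bullet,T_\circ)+R_{\overline{\mathfrak{r}}}(T_\circ,T_\bullet)}{2g-\mathring{n}_2(\mathfrak{r})}.$$
   Context: Maps are cellular embeddings of connected graphs in compact orientable surfaces, determined by counterclockwise cyclic orders at vertices. Blossoming maps carry extra dangling half-edges (stems), each a leaf (oriented towards its vertex) or a bud (oriented away); the interior degree of a vertex ignores stems, its degree counts them; 4-valent means all degrees equal $4$. A rooted blossoming map has a marked bud (root bud) whose preceding corner counterclockwise is the root corner. For a rooted unicellular (one-face) blossoming map, the clockwise contour is the cyclic sequence of corners and stems along the face boundary from the root corner with the face on the right. Canonical labeling: root corner $0$; next corner along the contour keeps its label across an edge traversal, gains $1$ across a bud, loses $1$ across a leaf; a stem between corners labelled $i-1$ and $i$ has label $i$; a leaf is black if its label is even, white if odd. Well-oriented: each edge oriented opposite to its first traversal by the contour. Well-labeled: corners on the same side of an edge have equal labels and consecutive corners around a vertex differ by $1$ with the larger on the left of the separating edge or stem. Well-rooted: as many leaves as buds and all labels nonnegative. A good map is a 4-valent, well-rooted, well-labeled, well-oriented rooted unicellular blossoming map. A blossoming core is a unicellular blossoming map all of whose vertices have interior degree at least $2$; a scheme vertex is a vertex of interior degree at least $3$. $\mathcal{R}$ is the set of rooted blossoming cores that are 4-valent,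 well-oriented, well-labeled and whose root bud is incident to a scheme vertex. For a subset $X$ of $\mathcal{R}$, $R_X(x,y)=\sum_{\mathfrak{r}\in X}x^{\ell_\bullet(\mathfrak{r})+1}y^{\ell_\circ(\mathfrak{r})}$, with $\ell_\bullet,\ell_\circ$ numbers of black and white leaves; for a set $Y$ of good maps, $O^\times_Y(z_\bullet,z_\circ)=\sum_{\mathfrak{o}\in Y}z_\bullet^{\ell_\bullet(\mathfrak{o})+1}z_\circ^{\ell_\circ(\mathfrak{o})}$. Unrooted core: for $\mathfrak{r}\in\mathcal{R}$ it is $\mathfrak{r}$ with its root bud turned into a leaf and no root; for a good map $\mathfrak{o}$ it is obtained by turning the root bud into a leaf and repeatedly deleting a vertex of interior degree $1$ with its stems, replacing its incident edge by a leaf at the neighbouring vertex. $R_{\overline{\mathfrak{r}}}$ is the series of the elements of $\mathcal{R}$ having the same unrooted core as $\mathfrak{r}$, and $O^\times_{\overline{\mathfrak{r}}}$ the series of good maps whose unrooted core equals that of $\mathfrak{r}$. $T_\bullet,T_\circ$ are the unique power series in $z_\bullet,z_\circ$ without constant term with $T_\bullet=z_\bullet+T_\bullet^2+2T_\circ T_\bullet$, $T_\circ=z_\circ+T_\circ^2+2T_\circ T_\bullet$. *)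

(* Defs.v *)
From mathcomp Require Import all_boot all_order all_fingroup all_algebra.

Set Implicit Arguments.
Unset Strict Implicit.
Unset Printing Implicit Defensive.

Import GRing.Theory Num.Theory.

Local Open Scope ring_scope.

(* A blossoming map is given by its set of half-edges (stems included), the
   counterclockwise rotation [rot] around vertices, and the involution [opp]
   exchanging the two halves of each edge, whose fixed points are the stems.
   A stem is a bud if it lies in [bud], and a leaf otherwise.  Edges carry no
   orientation here. *)
Record blossoming_map := BlossomingMap {
  dart :> finType;
  rot : {perm dart};
  opp : {perm dart};
  bud : {set dart};
  oppK : involutive opp;
  bud_is_stem : forall d, d \in bud -> opp d = d;
  map_connected :
    forall d e, connect (fun x y => (y == rot x) || (y == opp x)) d e
}.

Section BlossomingMap.

Variable m : blossoming_map.

Definition is_stem (d : m) : bool := opp m d == d.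
Definition is_leaf (d : m) : bool := is_stem d && (d \notin bud m).

Definition vertices : {set {set m}} := porbits (rot m).
Definition edges : {set {set m}} := [set e in porbits (opp m) | #|e| == 2%N].

Definition vertex_of (d : m) : {set m} := porbit (rot m) d.
Definition degree (v : {set m}) : nat := #|v|.
Definition interior_degree (v : {set m}) : nat := #|[set d in v | ~~ is_stem d]|.

Definition four_valent : bool := [forall v in vertices, degree v == 4%N].

(* A half-edge [d] also stands for the corner that precedes [d] in
   counterclockwise order around its vertex.  Walking with the face on the
   right, the corner of [d] is followed by [d] itself, which is crossed if it
   is a stem and traversed if it is half of an edge; in both cases the next
   corner is that of [rot (opp d)].  (In a product of permutations the left
   factor is applied first.) *)
Definition contour : {perm m} := (opp m * rot m)%g.

Definition faces : {set {set m}} := porbits contour.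
Definition unicellular : bool := #|faces| == 1%N.

Definition has_genus (g : nat) : Prop :=
  (#|vertices| + #|faces| + 2 * g = #|edges| + 2)%N.

Definition is_core : bool :=
  unicellular && [forall v in vertices, (2 <= interior_degree v)%N].

Definition num_interior_degree4 : nat :=
  #|[set v in vertices | interior_degree v == 4%N]|.

End BlossomingMap.

Definition map_iso (m m' : blossoming_map) : Prop :=
  exists f : m -> m',
    [/\ bijective f,
        forall d, f (rot m d) = rot m' (f d),
        forall d, f (opp m d) = opp m' (f d)
      & forall d, (f d \in bud m') = (d \in bud m)].

(* [m'] is [m] with a vertex [v] of interior degree 1 deleted together with
   its stems, the other half of the edge incident to [v] becoming a leaf;
   [f] identifies the half-edges of [m'] with the remaining ones of [m]. *)
Definition prune_step (m m' : blossoming_map) : Prop :=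
  exists (v : {set m}) (f : m' -> m),
    [/\ v \in vertices m /\ interior_degree v = 1%N,
        injective f /\ (forall d, (d \in codom f) = (d \notin v)),
        forall d, f (rot m' d) = rot m (f d),
        forall d, f (opp m' d) = if opp m (f d) \in v then f d else opp m (f d)
      & forall d, (d \in bud m') = (f d \in bud m)].

Inductive pruned_to (m : blossoming_map) : blossoming_map -> Prop :=
| PrunedDone (c : blossoming_map) :
    (forall v, v \in vertices m -> interior_degree v <> 1%N) ->
    map_iso m c -> pruned_to m c
| PrunedStep (m' c : blossoming_map) :
    prune_step m m' -> pruned_to m' c -> pruned_to m c.

(* [tail] selects from each edge the half at its origin. *)
Record rooted_map := RootedMap {
  underlying :> blossoming_map;
  root : underlying;
  tail : {set underlying};
  root_is_bud : root \in bud underlying;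
  tail_orientation : forall d : underlying,
    if is_stem d then d \notin tail
    else (opp underlying d \in tail) == (d \notin tail)
}.

Definition rooted_iso (r r' : rooted_map) : Prop :=
  exists f : r -> r',
    [/\ bijective f,
        (forall d, f (rot r d) = rot r' (f d))
        /\ (forall d, f (opp r d) = opp r' (f d)),
        forall d, (f d \in bud r') = (d \in bud r),
        forall d, (f d \in tail r') = (d \in tail r)
      & f (root r) = root r'].

Section RootedMap.

Variable r : rooted_map.

(* The root corner precedes the root bud, so it is the corner of [root r]. *)
Definition contour_time (d : r) : nat := findex (contour r) (root r) d.

Definition label_increment (d : r) : int :=
  if ~~ is_stem d then 0 else if d \in bud r then 1 else -1.

Definition corner_label (d : r) : int :=
  \sum_(k < contour_time d) label_increment (iter k (contour r) (root r)).

(* The larger of the labels of the two corners adjacent to the stem. *)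
Definition stem_label (d : r) : int :=
  Num.max (corner_label d) (corner_label (rot r d)).

Definition black_leaves : nat :=
  #|[set d : r | is_leaf d && (2%:Z %| stem_label d)%Z]|.
Definition white_leaves : nat :=
  #|[set d : r | is_leaf d && ~~ (2%:Z %| stem_label d)%Z]|.

(* An edge is first traversed from its half with the smaller contour time. *)
Definition well_oriented : Prop :=
  forall d : r, ~~ is_stem d ->
    (d \in tail r) = (contour_time (opp r d) < contour_time d)%N.

Definition points_away (d : r) : bool :=
  if is_stem d then d \in bud r else d \in tail r.

(* The two corners on the right-hand side of an edge traversed from [d] are
   those of [d] and of [rot (opp d)].  Around a vertex, the corners
   of [d] and [rot d] are separated by [d]; the latter is on the left of [d]
   exactly when [d] points away from the vertex. *)
Definition well_labeled : Prop :=
  (forall d : r, ~~ is_stem d ->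
     corner_label (rot r (opp r d)) = corner_label d)
  /\ (forall d : r, corner_label (rot r d)
        = corner_label d + (if points_away d then 1 else -1)).

(* The label of a stem is that of a corner, so it suffices to consider
   corners for nonnegativity. *)
Definition well_rooted : Prop :=
  #|[set d : r | is_leaf d]| = #|bud r|
  /\ (forall d : r, 0 <= corner_label d).

Definition good_map : Prop :=
  [/\ unicellular r, four_valent r, well_rooted, well_labeled & well_oriented].

Definition in_R : Prop :=
  [/\ is_core r, four_valent r, well_oriented, well_labeled
    & (3 <= interior_degree (vertex_of (root r)))%N].

Lemma unrooted_bud_is_stem (d : r) : d \in bud r :\ root r -> opp r d = d.
Proof. by move=> /setD1P[_]; exact: bud_is_stem. Qed.

(* Turns the root bud into a leaf and forgets the root.  The orientation of
   the edges is forgotten too: it is determined by the root, through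
   well-orientedness, and is not preserved by a change of root. *)
Definition unroot : blossoming_map :=
  BlossomingMap (@oppK r) unrooted_bud_is_stem (@map_connected r).

End RootedMap.

Definition same_unrooted_core (r r' : rooted_map) : Prop :=
  map_iso (unroot r) (unroot r').

Definition has_unrooted_core (o : rooted_map) (c : blossoming_map) : Prop :=
  pruned_to (unroot o) c.

(* Formal power series over the rationals in two variables: [F i j] is the
   coefficient of the monomial with exponents [i] and [j]. *)
Definition series2 := nat -> nat -> rat.

Definition series_one : series2 := fun i j => ((i == 0%N) && (j == 0%N))%:R.
Definition series_X : series2 := fun i j => ((i == 1%N) && (j == 0%N))%:R.
Definition series_Y : series2 := fun i j => ((i == 0%N) && (j == 1%N))%:R.

Definition series_mul (F G : series2) : series2 := fun i j =>
  \sum_(k < i.+1) \sum_(l < j.+1) F k l * G (i - k)%N (j - l)%N.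

Definition series_exp (F : series2) (n : nat) : series2 :=
  iter n (series_mul F) series_one.

(* Substitution F(G, H), for G and H without constant term: the terms
   G^k H^l with k + l > i + j do not contribute to the coefficient (i, j). *)
Definition series_subst (F G H : series2) : series2 := fun i j =>
  \sum_(k < (i + j).+1) \sum_(l < (i + j).+1)
    F k l * series_mul (series_exp G k) (series_exp H l) i j.

Definition T_system (Tb Tw : series2) : Prop :=
  [/\ Tb 0%N 0%N = 0, Tw 0%N 0%N = 0,
      forall i j, Tb i j
        = series_X i j + series_mul Tb Tb i j + 2 * series_mul Tw Tb i j
    & forall i j, Tw i j
        = series_Y i j + series_mul Tw Tw i j + 2 * series_mul Tw Tb i j].

(* [P] holds for exactly [k] rooted maps up to isomorphism. *)
Definition has_count (P : rooted_map -> Prop) (k : nat) : Prop :=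
  exists s : 'I_k -> rooted_map,
    [/\ forall i, P (s i),
        forall i j, rooted_iso (s i) (s j) -> i = j
      & forall r, P r -> exists i, rooted_iso (s i) r].

(* [F] is the sum over [P], up to isomorphism, of the monomials with exponents
   the number of black leaves plus one and the number of white leaves. *)
Definition is_generating_series (P : rooted_map -> Prop) (F : series2) : Prop :=
  forall i j, exists2 k : nat, F i j = k%:R &
    has_count (fun r => [/\ P r, (black_leaves r).+1 = i & white_leaves r = j]) k.

(* Main.v *)
Require Import Defs.
From HB Require Import structures.
From mathcomp Require Import all_boot all_order all_fingroup all_algebra.
From mathcomp Require Import boolp zify ring.
Import Defs.

(* Once the root bud of a good map is turned into a leaf, each turn of the
   contour decreases the labels by 2, and being well-labeled and well-oriented
   no longer depends on the root.  By the cycle lemma such an unrooted map has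
   exactly two admissible roots, one of each colour.  It is its core [c] with a
   plane tree grafted on every leaf, the trees being counted by T_black or
   T_white according to the colour of the leaf.  As rooted maps are rigid,
   |Aut c| times the number of good maps with core [c] is thus given by
   T_black^a T_white^b + T_white^a T_black^b, where [a] and [b] are the numbers
   of leaves of each colour in [c].  Likewise |Aut c| times the series of the
   rooted cores sums one monomial x^a y^b or x^b y^a over the leaves of [c] at
   scheme vertices.  There are 2g - n_2 of these leaves, because every vertex
   of interior degree 2 carries one bud and one leaf. *)

Set Implicit Arguments.
Unset Strict Implicit.
Unset Printing Implicit Defensive.

Import Order.TTheory GRing.Theory Num.Theory.

Local Open Scope ring_scope.

(** * Labellings along the contour *)

(** Labels are read from an arbitrary corner [x0] of the unrooted map. The root of a good map may
    lie in a grafted tree, whereas the corners of the core are still there after grafting and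
    pruning; a change of base shifts all parities uniformly, hence the flag [eps] that exchanges the
    two colours. Pruning may be done in any order, and comparing two pruning sequences would call
    for a confluence argument. Instead the core sits in the larger map through an [embedding], an
    intrinsic notion: two images of the core coincide, so two embeddings differ by an automorphism
    of the core. The grown maps are counted coefficient by coefficient, without a type of plane
    trees: turning one leaf into a vertex with one bud and two leaves mirrors one use of the
    equations for [Tb] and [Tw]. The induction runs on maps with a marked copy of the core, because
    isomorphism classes alone do not behave multiplicatively; the symmetry factor, which enters both
    counts, is divided out afterwards. *)

Definition weight (m : blossoming_map) (d : m) : int :=
  if ~~ is_stem d then 0 else if d \in bud m then 1 else -1.

Lemma contourE (m : blossoming_map) (d : m) : contour m d = rot m (opp m d).
Proof. by rewrite permM. Qed.

Lemma rot_contour (m : blossoming_map) (d : m) : rot m d = contour m (opp m d).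
Proof. by rewrite contourE oppK. Qed.

Lemma bud_stem (m : blossoming_map) (d : m) : d \in bud m -> is_stem d.
Proof. by move=> /bud_is_stem/eqP. Qed.

Lemma nonstem_opp (m : blossoming_map) (d : m) : is_stem (opp m d) = is_stem d.
Proof. by rewrite /is_stem oppK eq_sym. Qed.

Lemma weight_leaf (m : blossoming_map) (d : m) : is_leaf d -> weight d = -1.
Proof. by case/andP=> s b; rewrite /weight s /= (negbTE b). Qed.

Lemma weight_eqN1 (m : blossoming_map) (d : m) : weight d <= -1 -> is_leaf d.
Proof. by rewrite /weight /is_leaf; case: (is_stem d); case: (d \in bud m). Qed.

Lemma weight_geN1 (m : blossoming_map) (d : m) : -1 <= weight d.
Proof. by rewrite /weight; case: (is_stem d); case: (d \in bud m). Qed.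

Lemma sum_weight_set (m : blossoming_map) (S : {set m}) :
  \sum_(d in S) weight d = #|S :&: bud m|%:R - #|S :&: [set d | is_leaf d]|%:R :> int.
Proof.
have cardE (B : {set m}) : #|S :&: B|%:R = \sum_(d in S) (d \in B)%:R :> int.
  rewrite -sum1_card natr_sum (eq_bigl (fun d => (d \in S) && (d \in B))) => [|d]; last by rewrite inE.
  by rewrite big_mkcondr; apply: eq_bigr => d _; case: (d \in B).
rewrite !cardE -sumrB; apply: eq_bigr => d _; rewrite inE /weight /is_leaf.
by have [/bud_stem ->//|_] := boolP (d \in bud m); case: (is_stem d).
Qed.

Lemma porbit_fconnect (T : finType) (s : {perm T}) (x y : T) :
  (y \in porbit s x) = fconnect s x y.
Proof.
apply/porbitP/idP => [[i ->]|/iter_findex <-]; first by rewrite permX fconnect_iter.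
by exists (findex s x y); rewrite permX.
Qed.

Lemma unicellularE (m : blossoming_map) (x0 : m) :
  unicellular m <-> forall d, fconnect (contour m) x0 d.
Proof.
rewrite /unicellular /faces; split=> [/cards1P[A defA] d|conn].
  have: porbit (contour m) x0 \in porbits (contour m) by exact: imset_f.
  have: porbit (contour m) d \in porbits (contour m) by exact: imset_f.
  rewrite defA !inE => /eqP <- /eqP eqo.
  by rewrite -porbit_fconnect eqo porbit_id.
apply/cards1P; exists (porbit (contour m) x0); apply/setP=> A; rewrite !inE.
apply/imsetP/eqP=> [[d _ ->]|->]; last by exists x0.
by apply/eqP; rewrite eq_porbit_mem porbit_fconnect conn.
Qed.

Lemma findex_contour_connect (m : blossoming_map) (x0 : m) :
    (forall d, fconnect (contour m) x0 d) -> forall d, contour m d != x0 ->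
  findex (contour m) x0 (contour m d) = (findex (contour m) x0 d).+1.
Proof.
move=> conn d neq0; have ltd := findex_max (conn d).
rewrite -{1}(iter_findex (conn d)) -iterS findex_iter // ltn_neqAle ltd andbT.
apply: contraNneq neq0 => eq_o.
by rewrite -(iter_findex (conn d)) -iterS eq_o iter_order //; apply: perm_inj.
Qed.

Section Labelling.

Variables (m : blossoming_map) (x0 : m).

(* [t] orders the corners along the contour started at [x0], and [h] labels
   them; a full turn of the contour decreases the labels by 2. *)
Definition labelling (t : m -> nat) (h : m -> int) : Prop :=
  [/\ injective t, h x0 = 0,
      forall d, contour m d != x0 -> (t d < t (contour m d))%N,
      forall d, h (contour m d) = h d + weight d + (if contour m d == x0 then 2 else 0)
    & forall d, ~~ is_stem d -> (t d < t (opp m d))%N -> h (opp m d) = h d - 1].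

Definition lab (d : m) : int :=
  \sum_(k < findex (contour m) x0 d) weight (iter k (contour m) x0).

Definition labelled : Prop := labelling (findex (contour m) x0) lab.

Section WithLabelling.

Variables (t : m -> nat) (h : m -> int).
Hypothesis lab_th : labelling t h.

(** Stepping back along the contour strictly decreases [t] until [x0] is reached, so the existence
    of [t] already entails a single face. *)
Lemma labelling_connect d : fconnect (contour m) x0 d.
Proof.
case: lab_th => _ _ tS _ _.
have [n] := ubnP (t d); elim: n d => // n IHn d lt_dn.
have [->|d_neq] := eqVneq d x0; first exact: connect0.
have := tS ((contour m)^-1%g d); rewrite permKV => /(_ d_neq) lt_t.
apply: connect_trans (IHn ((contour m)^-1%g d) _) _; first lia.
by apply: connect1; rewrite /= permKV.
Qed.

Lemma labelling_iter k :
  (k.+1 < fingraph.order (contour m) x0)%N -> iter k.+1 (contour m) x0 != x0.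
Proof.
by move=> ltk; apply/eqP=> /(congr1 (findex (contour m) x0)); rewrite findex_iter ?findex0.
Qed.

Lemma labelling_lt k l : (k < l)%N -> (l < fingraph.order (contour m) x0)%N ->
  (t (iter k (contour m) x0) < t (iter l (contour m) x0))%N.
Proof.
case: lab_th => _ _ tS _ _.
elim: l => // l IHl; rewrite ltnS leq_eqVlt => /predU1P[->|ltkl] ltl.
  by apply: tS; apply: labelling_iter.
apply: ltn_trans (IHl ltkl (ltnW ltl)) _.
by apply: tS; apply: labelling_iter.
Qed.

Lemma labelling_findex_lt d e :
  (findex (contour m) x0 d < findex (contour m) x0 e)%N = (t d < t e)%N.
Proof.
have lt_mono u v : (findex (contour m) x0 u < findex (contour m) x0 v)%N -> (t u < t v)%N.
  move=> luv; have := labelling_lt luv (findex_max (labelling_connect v)).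
  by rewrite !iter_findex //; apply: labelling_connect.
case: (ltngtP (findex (contour m) x0 d) (findex (contour m) x0 e)) => [||eq_f].
- by move/lt_mono=> ->.
- by move/lt_mono=> lt_ed; apply/esym/negbTE; rewrite -leqNgt ltnW.
suff -> : d = e by rewrite ltnn.
by rewrite -(iter_findex (labelling_connect d)) eq_f iter_findex ?labelling_connect.
Qed.

Lemma labelling_iterE k : (k < fingraph.order (contour m) x0)%N ->
  h (iter k (contour m) x0) = \sum_(i < k) weight (iter i (contour m) x0).
Proof.
case: lab_th => _ h0 _ hS _; elim: k => [|k IHk] ltk; first by rewrite big_ord0.
rewrite big_ord_recr /= -IHk ?(ltnW ltk) // hS -iterS.
by rewrite (negbTE (labelling_iter ltk)) addr0.
Qed.

Lemma labellingE d : h d = lab d.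
Proof.
rewrite /lab -labelling_iterE ?findex_max ?iter_findex //; exact: labelling_connect.
Qed.

Lemma findex_contour_inj : injective (findex (contour m) x0).
Proof.
move=> d e eq_f.
by rewrite -(iter_findex (labelling_connect d)) eq_f iter_findex ?labelling_connect.
Qed.

(** Any [t] and [h] obeying the local rules are as good as the contour index and [lab]: [h] equals
    [lab], and [t] induces the same order. Change of base, expansion, pruning and isomorphisms
    exhibit convenient [t] and [h] instead of computing [findex] on the new map. *)
Lemma labelling_labelled : labelled.
Proof.
case: lab_th => t_inj h0 tS hS hE; split.
- exact: findex_contour_inj.
- by rewrite -labellingE.
- by move=> d /tS; rewrite labelling_findex_lt.
- by move=> d; rewrite -!labellingE.
by move=> d ds; rewrite labelling_findex_lt -!labellingE; apply: hE.
Qed.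

End WithLabelling.

Hypothesis lab_m : labelled.

Lemma labelled_connect d : fconnect (contour m) x0 d.
Proof. exact: (labelling_connect lab_m). Qed.

Lemma labelled_unicellular : unicellular m.
Proof. by apply/(unicellularE x0); apply: labelled_connect. Qed.

Lemma findex_contourS d : contour m d != x0 ->
  findex (contour m) x0 (contour m d) = (findex (contour m) x0 d).+1.
Proof. exact: findex_contour_connect labelled_connect d. Qed.

Lemma findex_contour_last d : contour m d = x0 ->
  forall e, (findex (contour m) x0 e <= findex (contour m) x0 d)%N.
Proof.
move=> eq0 e; have [e' _ max_e'] := arg_maxnP (fun d => findex (contour m) x0 d) (i0 := e) isT.
suff -> : d = e' by apply: max_e'.
apply: (@perm_inj _ (contour m)); rewrite eq0; apply/esym/eqP.
apply: contraT => /findex_contourS eqS.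
by have := max_e' (contour m e') isT; rewrite eqS /= ltnn.
Qed.

Lemma lab0 : lab x0 = 0.
Proof. by rewrite /lab findex0 big_ord0. Qed.

Lemma labS d : lab (contour m d) = lab d + weight d + (if contour m d == x0 then 2 else 0).
Proof. by case: lab_m. Qed.

Lemma lab_opp d : ~~ is_stem d ->
  lab (opp m d) = lab d +
    (if (findex (contour m) x0 d < findex (contour m) x0 (opp m d))%N then -1 else 1).
Proof.
case: lab_m => f_inj _ _ _ hE ds; case: ltnP => [/(hE d ds) ->//|le_f].
have := hE (opp m d); rewrite nonstem_opp oppK => -> //; first by rewrite subrK.
rewrite ltn_neqAle le_f andbT; apply: contraNneq ds => /f_inj eqd.
by rewrite /is_stem eqd.
Qed.

(** The labels telescope around the closed contour; the only defect is the jump of 2 at the return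
    to [x0]. *)
Lemma sum_weight : \sum_d @weight m d = -2.
Proof.
have: \sum_d lab (contour m d) = \sum_d lab d.
  by rewrite [RHS](reindex_inj (@perm_inj _ (contour m))).
under eq_bigr do rewrite labS.
have -> : \sum_d (lab d + @weight m d + (if contour m d == x0 then 2 else 0))
    = \sum_d lab d + (\sum_d @weight m d + 2).
  rewrite !big_split /= -addrA; congr (_ + (_ + _)).
  rewrite -big_mkcond /= (big_pred1 ((contour m)^-1%g x0)) // => d.
  by rewrite (can2_eq (permK _) (permKV _)).
move=> e; apply: (addIr 2); rewrite addNr; apply: (addrI (\sum_d lab d)).
by rewrite e addr0.
Qed.

Lemma card_leaf_bud : #|[set d | @is_leaf m d]| = (#|bud m| + 2)%N.
Proof.
have := sum_weight; rewrite (eq_bigl (mem [set: m])) => [|d]; last by rewrite /= inE.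
rewrite sum_weight_set !setTI; lia.
Qed.

End Labelling.

(** Seen from [s], the corners preceding [s] come one turn later and thus 2 lower. The delicate case
    is an edge with one side in each part: the order of its two traversals is reversed, and the
    label difference across it passes from -1 to -1 + 2 = 1, as the edge rule demands in the new
    order. *)
Lemma labelled_change_base (m : blossoming_map) (x0 s : m) : labelled x0 ->
  labelled s /\ forall d, lab s d = lab x0 d - lab x0 s
    - (if (findex (contour m) x0 d < findex (contour m) x0 s)%N then 2 else 0).
Proof.
move=> lab_m; have [f_inj _ fS hS hE] := lab_m.
set f := findex (contour m) x0 in f_inj fS hE *.
(* Added to the times of the corners before [s], this bound sends them behind all the others. *)
pose M := (\max_d f d).+1.
have ltM d : (f d < M)%N by rewrite ltnS leq_bigmax.
pose t d := if (f d < f s)%N then (f d + M)%N else f d.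
pose h d := lab x0 d - lab x0 s - (if (f d < f s)%N then 2 else 0).
have f0 : f x0 = 0%N by apply: findex0.
have pos : (0 < f s)%N = (s != x0) by rewrite lt0n -(inj_eq f_inj) f0.
suff th : labelling s t h.
  split=> [|d]; first exact: labelling_labelled th.
  by rewrite -(labellingE th).
split.
- move=> d e; rewrite /t; have := ltM d; have := ltM e.
  case: ifP; case: ifP => lt1 lt2 ? ? eqt; apply: f_inj; lia.
- by rewrite /h ltnn; lia.
- move=> d neq_s; rewrite /t; have [eq0|neq0] := eqVneq (contour m d) x0.
    have := findex_contour_last lab_m eq0 s; rewrite -/f eq0 f0 leqNgt => /negbTE -> .
    by rewrite pos eq_sym -{1}eq0 neq_s add0n.
  have fd := findex_contourS lab_m neq0; rewrite -/f in fd.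
  move: neq_s; rewrite -(inj_eq f_inj) fd; have := ltM d; case: ifP; case: ifP; lia.
- move=> d; rewrite /h hS; have [eq0|neq0] := eqVneq (contour m d) x0.
    have := findex_contour_last lab_m eq0 s; rewrite -/f eq0 f0 leqNgt => /negbTE -> .
    by rewrite pos (eq_sym s); case: eqP => _ /=; lia.
  have fd := findex_contourS lab_m neq0; rewrite -/f in fd.
  have := inj_eq f_inj (contour m d) s; rewrite fd => <-.
  by case: eqP; case: (ltnP (f d).+1); case: (ltnP (f d)); lia.
move=> d ds; rewrite /h /t lab_opp // -/f.
have := ltM d; have := ltM (opp m d).
by case: ifP; case: ifP; case: ifP; lia.
Qed.

(** * Expansion of a leaf *)

Section Expand.

Variables (m : blossoming_map) (a : m) (b : 'I_3).
Hypothesis leaf_a : is_leaf a.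

Definition expand_rot_fun (x : m + 'I_4) : m + 'I_4 :=
  match x with inl d => inl (rot m d) | inr i => inr (i + 1) end.

Definition expand_opp_fun (x : m + 'I_4) : m + 'I_4 :=
  match x with
  | inl d => if d == a then inr 0 else inl (opp m d)
  | inr i => if i == 0 then inl a else inr i
  end.

Lemma expand_rot_inj : injective expand_rot_fun.
Proof.
move=> [d|i] [e|j] //= eq_de; congr (_ _).
  exact: perm_inj (inl_inj eq_de).
exact: addIr (inr_inj eq_de).
Qed.

Lemma opp_leaf : opp m a = a.
Proof. by case/andP: leaf_a => /eqP. Qed.

Lemma expand_oppK_fun : involutive expand_opp_fun.
Proof.
move=> [d|i] /=; last by have [->|/negbTE i0] := eqVneq i 0; rewrite /= ?eqxx ?i0.
have [->|/negbTE da] := eqVneq d a; first by rewrite /= ?eqxx.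
by rewrite /= (can2_eq (@oppK m) (@oppK m)) opp_leaf da oppK.
Qed.

Definition expand_rot : {perm m + 'I_4} := perm expand_rot_inj.
Definition expand_opp : {perm m + 'I_4} := perm (inv_inj expand_oppK_fun).
Definition expand_bud : {set m + 'I_4} :=
  [set x | match x with inl d => d \in bud m | inr i => i == lift ord0 b end].

Lemma expand_oppK : involutive expand_opp.
Proof. by move=> x; rewrite !permE expand_oppK_fun. Qed.

Lemma expand_bud_is_stem x : x \in expand_bud -> expand_opp x = x.
Proof.
rewrite inE permE; case: x => [d|i] /=; last by move=> /eqP ->.
have [->|_ /bud_is_stem ->//] := eqVneq d a.
by case/andP: leaf_a => _ /negbTE ->.
Qed.

Lemma expand_connected x y :
  connect (fun x y => (y == expand_rot x) || (y == expand_opp x)) x y.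
Proof.
set r := fun _ _ => _.
have inlS d d' : connect r (inl d) (inl d').
  have /connectP[p] := map_connected d d'.
  elim: p d => [|e p IHp] d /= => [_ ->|/andP[/orP[]/eqP eqe pathp eqd]].
  - exact: connect0.
  - apply: connect_trans (IHp e pathp eqd); apply: connect1.
    by rewrite /r permE /= -eqe eqxx.
  - apply: connect_trans (IHp e pathp eqd).
    have [da|/negbTE da] := eqVneq d a; first by rewrite eqe da opp_leaf connect0.
    by apply: connect1; rewrite /r !permE /= da -eqe eqxx orbT.
have inrS i j : connect r (inr i) (inr j).
  have stepS k n : connect r (inr k) (inr (k + n%:R)).
    elim: n => [|n IHn]; first by rewrite addr0 connect0.
    apply: connect_trans IHn _; apply: connect1.
    by rewrite /r permE /= -addrA -natr1 eqxx.
  by have := stepS i (j - i); rewrite natr_Zp addrC subrK.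
have la0 : connect r (inl a) (inr 0).
  by apply: connect1; apply/orP; right; rewrite permE /= ?eqxx.
have l0a : connect r (inr 0) (inl a).
  by apply: connect1; apply/orP; right; rewrite permE /= ?eqxx.
case: x y => [d|i] [d'|j] //.
  exact: connect_trans (connect_trans (inlS _ _) la0) (inrS _ _).
exact: connect_trans (connect_trans (inrS _ _) l0a) (inlS _ _).
Qed.

(* The leaf [a] becomes an edge towards a new vertex, whose half-edges are
   numbered counterclockwise from that edge, with a bud in position [b + 1]. *)
Definition expand : blossoming_map :=
  BlossomingMap expand_oppK expand_bud_is_stem expand_connected.

Lemma expand_rotl d : rot expand (inl d) = inl (rot m d).
Proof. by rewrite permE. Qed.

Lemma expand_rotr i : rot expand (inr i) = inr (i + 1).
Proof. by rewrite permE. Qed.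

Lemma expand_oppl d : opp expand (inl d) = if d == a then inr 0 else inl (opp m d).
Proof. by rewrite permE. Qed.

Lemma expand_oppr i : opp expand (inr i) = if i == 0 then inl a else inr i.
Proof. by rewrite permE. Qed.

Lemma expand_budl d : ((inl d : expand) \in bud expand) = (d \in bud m).
Proof. by rewrite inE. Qed.

Lemma expand_budr i : ((inr i : expand) \in bud expand) = (i == lift ord0 b).
Proof. by rewrite inE. Qed.

Lemma expand_steml d : is_stem (inl d : expand) = (d != a) && is_stem d.
Proof. by rewrite /is_stem expand_oppl; case: ifP. Qed.

Lemma expand_stemr i : is_stem (inr i : expand) = (i != 0).
Proof. by rewrite /is_stem expand_oppr; case: ifP; rewrite ?eqxx. Qed.

Lemma expand_leafl d : is_leaf (inl d : expand) = (d != a) && is_leaf d.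
Proof. by rewrite /is_leaf expand_steml expand_budl andbA. Qed.

Lemma expand_leafr i : is_leaf (inr i : expand) = (i != 0) && (i != lift ord0 b).
Proof. by rewrite /is_leaf expand_stemr expand_budr. Qed.

Lemma expand_contourl d :
  contour expand (inl d) = if d == a then inr 1 else inl (contour m d).
Proof.
rewrite contourE expand_oppl; case: ifP; first by rewrite expand_rotr add0r.
by rewrite expand_rotl contourE.
Qed.

Lemma expand_contourr i :
  contour expand (inr i) = if i == 0 then inl (contour m a) else inr (i + 1).
Proof.
rewrite contourE expand_oppr; case: ifP; rewrite ?expand_rotl ?expand_rotr //.
by rewrite contourE opp_leaf.
Qed.

Lemma ord4_ind (P : 'I_4 -> Prop) : P 0 -> P 1 -> P 2%:R -> P 3%:R -> forall i, P i.
Proof.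
move=> P0 P1 P2 P3 i.
have : i \in [:: 0; 1; 2%:R; 3%:R] by case: i => [[|[|[|[|]]]] lti].
by rewrite !inE => /or4P[] /eqP ->.
Qed.

(** Labels of the new corners relative to that of [a]. Corner 1 keeps the label of [a] across the
    edge, and the contour then crosses stems 1, 2, 3. One bud and two leaves sum to -1: this is the
    value that the edge rule requires at corner 0, and also the weight of the leaf [a], so all old
    labels persist. *)
Definition expand_shift (i : 'I_4) : int :=
  if i == 0 then -1 else if i == 1 then 0
  else if i == 2%:R then (if b == 0 then 1 else -1) else (if b == 2%:R then -2 else 0).

Variable x0 : m.
Hypothesis lab_m : labelled x0.

Lemma expand_labelled_lab :
  labelled (inl x0 : expand) /\
  forall x : expand, lab (inl x0 : expand) x =
    match x with inl d => lab x0 d | inr i => lab x0 a + expand_shift i end.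
Proof.
have [f_inj h0 fS hS hE] := lab_m.
set f := findex (contour m) x0 in f_inj fS hE *.
(* The factor 5 leaves room after [a] for the four new corners, visited in the order 1, 2, 3, 0. *)
pose t (x : expand) := match x with
  | inl d => (5 * f d)%N
  | inr i => (5 * f a + (if i == 0%R :> 'I_4 then 4 else i))%N end.
pose h (x : expand) :=
  match x with inl d => lab x0 d | inr i => lab x0 a + expand_shift i end.
have weightr i : weight (inr i : expand) =
    if i == 0 then 0 else if i == lift ord0 b then 1 else -1.
  by rewrite /weight expand_stemr expand_budr; case: (i == 0).
have weightl d : weight (inl d : expand) = if d == a then 0 else weight d.
  by rewrite /weight expand_steml expand_budl; case: (d == a).
suff th : labelling (inl x0 : expand) t h.
  split=> [|x]; first exact: labelling_labelled th.
  by rewrite -(labellingE th).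
split.
- move=> [d|i] [e|j]; rewrite /t => eqt.
  + by congr inl; apply: f_inj; lia.
  + have [f_eq|f_neq] := eqVneq (f d) (f a).
      by move: eqt; rewrite f_eq; elim/ord4_ind: j => /=; lia.
    by move: eqt f_neq; elim/ord4_ind: j => /=; lia.
  + by move: eqt; elim/ord4_ind: i => /=; lia.
  congr inr; apply/eqP; move: eqt.
  by elim/ord4_ind: i; elim/ord4_ind: j => //=; lia.
- exact: h0.
- move=> [d|i]; rewrite ?expand_contourl ?expand_contourr.
    have [->|da] := eqVneq d a; first by move=> _; rewrite /t /=; lia.
    move=> neq; have := fS d; rewrite (contra_neq _ neq) => [/(_ isT)|->//].
    by rewrite /t; lia.
  elim/ord4_ind: i => //=; rewrite /t //=; try lia.
  move=> neq; have := fS a; rewrite (contra_neq _ neq) => [/(_ isT)|->//].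
  by lia.
- move=> [d|i]; rewrite ?expand_contourl ?expand_contourr ?weightl ?weightr.
    have [->|da] := eqVneq d a; first by rewrite /h /expand_shift /=; lia.
    by rewrite /h hS (inj_eq (@inl_inj _ _)).
  rewrite /h /expand_shift; case: ifP => [_|].
    by rewrite hS (weight_leaf leaf_a) addr0 (inj_eq (@inl_inj _ _)).
  have bP : b = 0 \/ b = 1 \/ b = 2%:R.
    by case: (b) => [[|[|[|//]]] ?]; [left|right; left|right; right]; apply: val_inj.
  by elim/ord4_ind: i => //; case: bP => [|[|]] ->  _ //=; lia.
move=> [d|i]; rewrite ?expand_steml ?expand_stemr ?expand_oppl ?expand_oppr.
  have [->|da] := eqVneq d a; first by rewrite /h /expand_shift /=.
  by move=> /= ds; rewrite /t /h => lt; apply: hE => //; lia.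
by case: (eqVneq i 0) => // -> _; rewrite /t /=; lia.
Qed.

End Expand.
Arguments expand : simpl never.

(** * Isomorphisms and embeddings *)

Section Isomorphisms.

Variables (m m' : blossoming_map) (f : m -> m').

Definition is_iso : Prop :=
  [/\ bijective f, forall d, f (rot m d) = rot m' (f d),
      forall d, f (opp m d) = opp m' (f d)
    & forall d, (f d \in bud m') = (d \in bud m)].

Hypothesis iso_f : is_iso.

Lemma iso_inj : injective f.
Proof. by case: iso_f => /bij_inj. Qed.

Lemma iso_stem d : is_stem (f d) = is_stem d.
Proof. by case: iso_f => _ _ fo _; rewrite /is_stem -fo (inj_eq iso_inj). Qed.

Lemma iso_leaf d : is_leaf (f d) = is_leaf d.
Proof. by case: iso_f => _ _ _ fb; rewrite /is_leaf iso_stem fb. Qed.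

Lemma iso_weight d : weight (f d) = weight d.
Proof. by case: iso_f => _ _ _ fb; rewrite /weight iso_stem fb. Qed.

Lemma iso_contour d : f (contour m d) = contour m' (f d).
Proof. by case: iso_f => _ fr fo _; rewrite !contourE fr fo. Qed.

Lemma iso_labelled x0 : labelled x0 ->
  labelled (f x0) /\ forall d, lab (f x0) (f d) = lab x0 d.
Proof.
move=> lab_m; have [[g fK gK] _ fo _] := iso_f; have [f_inj h0 fS hS hE] := lab_m.
have gc y : g (contour m' y) = contour m (g y) by apply: (canLR fK); rewrite iso_contour gK.
have go y : g (opp m' y) = opp m (g y) by apply: (canLR fK); rewrite fo gK.
have gs y : is_stem (g y) = is_stem y by rewrite -iso_stem gK.
have gw y : weight (g y) = weight y by rewrite -iso_weight gK.
have th : labelling (f x0) (findex (contour m) x0 \o g) (@lab m x0 \o g).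
  split=> /=.
  - by move=> y z /f_inj/(congr1 f); rewrite !gK.
  - by rewrite fK.
  - by move=> y neq; rewrite gc; apply: fS; apply: contra_neq neq => <-; rewrite -gc gK.
  - by move=> y; rewrite gc hS gw -gc (can2_eq gK fK).
  by move=> y; rewrite go -gs; apply: hE.
split=> [|d]; first exact: labelling_labelled th.
by rewrite -(labellingE th) /= fK.
Qed.

Lemma iso_vertex d : vertex_of (f d) = f @: vertex_of d.
Proof.
case: iso_f => _ fr _ _; have fi n e : f (iter n (rot m) e) = iter n (rot m') (f e).
  by elim: n => //= n <-; rewrite fr.
apply/setP=> y; apply/porbitP/imsetP=> [[i ->]|[z /porbitP[i ->] ->]].
  exists (iter i (rot m) d); last by rewrite permX fi.
  by apply/porbitP; exists i; rewrite permX.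
by exists i; rewrite !permX fi.
Qed.

Lemma iso_interior_degree (v : {set m}) : interior_degree (f @: v) = interior_degree v.
Proof.
rewrite /interior_degree -(card_imset _ iso_inj); apply: eq_card => y.
apply/idP/imsetP=> [|[d]]; rewrite !inE.
  by case/andP=> /imsetP[d dv ->]; rewrite iso_stem => ds; exists d; rewrite ?inE ?dv.
by case/andP=> dv ds ->; rewrite imset_f // iso_stem.
Qed.

Lemma iso_vertices (v : {set m}) : (f @: v \in vertices m') = (v \in vertices m).
Proof.
apply/imsetP/imsetP=> [[y _]|[d _ ->]]; last by exists (f d); rewrite // -iso_vertex.
have [[g fK gK] _ _ _] := iso_f; have : vertex_of y = f @: vertex_of (g y) by rewrite -iso_vertex gK.
by rewrite /vertex_of => -> /(imset_inj iso_inj) ->; exists (g y).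
Qed.

End Isomorphisms.

Lemma iso_inv (m m' : blossoming_map) (f : m -> m') (g : m' -> m) :
  is_iso f -> cancel f g -> cancel g f -> is_iso g.
Proof.
move=> [_ fr fo fb] fK gK; split; first by exists f.
- by move=> y; apply: (canLR fK); rewrite fr gK.
- by move=> y; apply: (canLR fK); rewrite fo gK.
by move=> y; rewrite -fb gK.
Qed.

Lemma is_iso_comp (m1 m2 m3 : blossoming_map) (g : m2 -> m3) (f : m1 -> m2) :
  is_iso g -> is_iso f -> is_iso (g \o f).
Proof.
move=> [gb gr go gu] [fb fr fo fu]; split => /=; first exact: bij_comp.
- by move=> d; rewrite fr gr.
- by move=> d; rewrite fo go.
by move=> d; rewrite gu fu.
Qed.

Lemma map_iso_sym m m' : map_iso m m' -> map_iso m' m.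
Proof.
case=> f iso_f; have [[g fK gK] _ _ _] := iso_f.
by exists g; apply: (iso_inv iso_f).
Qed.

Lemma map_iso_trans m1 m2 m3 : map_iso m1 m2 -> map_iso m2 m3 -> map_iso m1 m3.
Proof. by move=> [f iso_f] [g iso_g]; exists (g \o f); apply: is_iso_comp. Qed.

Lemma pruned_to_iso m u c : pruned_to m c -> map_iso m u -> pruned_to u c.
Proof.
move=> pr; elim: pr u => {m c} [m c deg1 mc u mu|m m' c [v [f [[vm v1] [f_inj fcod] fr fo fb]]] pr IH u [g iso_g]].
  apply: PrunedDone (map_iso_trans (map_iso_sym mu) mc) => v vu.
  have [g iso_g] := map_iso_sym mu.
  by rewrite -(iso_interior_degree iso_g); apply: deg1; rewrite (iso_vertices iso_g).
apply: PrunedStep pr; exists (g @: v), (g \o f).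
have g_inj := iso_inj iso_g; have [_ gr go gb] := iso_g; split => /=.
- by rewrite (iso_vertices iso_g) (iso_interior_degree iso_g).
- split=> [|y]; first exact: inj_comp.
  have [[h gK hK] _ _ _] := iso_g; rewrite -(hK y) mem_imset // -fcod.
  by apply/codomP/codomP=> -[d]; [move=> /g_inj ->|move=> ->]; exists d.
- by move=> d; rewrite fr gr.
- by move=> d; rewrite fo -go mem_imset //; case: ifP.
by move=> d; rewrite fb gb.
Qed.

Definition linked (u : blossoming_map) (W : {pred u}) (z : u) : bool :=
  ~~ is_stem z && (opp u z \in W).

(* [e] exhibits [m] as obtained from [u] by cutting off plane trees, each
   replaced by a leaf: the complement of the image contains no vertex set in
   which every vertex sends two half-edges to that set or to the image. *)
Record embedding (m u : blossoming_map) (e : m -> u) : Prop := Embedding {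
  emb_inj : injective e;
  emb_rot : forall d, e (rot m d) = rot u (e d);
  emb_bud : forall d, (e d \in bud u) = (d \in bud m);
  emb_opp : forall d,
    e (opp m d) = if opp u (e d) \in codom e then opp u (e d) else e d;
  emb_out : forall y, y \notin codom e ->
    #|vertex_of y| = 4%N /\ #|vertex_of y :&: bud u| = 1%N;
  emb_forest : forall V : {set u}, V != set0 -> (forall y, y \in V -> rot u y \in V) ->
    (forall d, e d \notin V) ->
    exists2 y, y \in V & forall z z', z \in vertex_of y -> z' \in vertex_of y ->
      linked [predU V & codom e] z -> linked [predU V & codom e] z' -> z = z'
}.

Lemma stable_vertex (u : blossoming_map) (V : {set u}) y z :
  (forall y, y \in V -> rot u y \in V) -> y \in V -> z \in vertex_of y -> z \in V.
Proof. by move=> VS yV /porbitP[i ->]; rewrite permX; elim: i => //= i /VS. Qed.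

Lemma vertex_of_rot (u : blossoming_map) (y z : u) :
  z \in vertex_of y -> rot u z \in vertex_of y.
Proof. by case/porbitP=> i ->; apply/porbitP; exists i.+1; rewrite expgSr permM. Qed.

Section EmbeddingTheory.

Variables (m u : blossoming_map) (e : m -> u).
Hypothesis emb_e : embedding e.

Lemma emb_codom_rot y : (rot u y \in codom e) = (y \in codom e).
Proof.
apply/codomP/codomP=> [[d]|[d ->]]; last by exists (rot m d); rewrite emb_rot.
rewrite -(permKV (rot m) d) emb_rot // => /perm_inj ->.
by exists ((rot m)^-1%g d).
Qed.

Lemma emb_vertex d : vertex_of (e d) = e @: vertex_of d.
Proof.
have fi n x : e (iter n (rot m) x) = iter n (rot u) (e x).
  by elim: n => //= n <-; rewrite emb_rot.
apply/setP=> y; apply/porbitP/imsetP=> [[i ->]|[z /porbitP[i ->] ->]].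
  exists (iter i (rot m) d); last by rewrite permX fi.
  by apply/porbitP; exists i; rewrite permX.
by exists i; rewrite !permX fi.
Qed.

Lemma emb_nonstem d : ~~ is_stem d -> opp u (e d) = e (opp m d).
Proof.
move=> ds; have := emb_opp emb_e d; case: ifP => // _ /(emb_inj emb_e) eqd.
by move: ds; rewrite /is_stem eqd eqxx.
Qed.

Lemma emb_is_stem d : ~~ is_leaf d -> is_stem (e d) = is_stem d.
Proof.
rewrite /is_leaf => ds; have [sd|/[dup] nsd /emb_nonstem] := boolP (is_stem d).
  by move: ds; rewrite sd negbK -(emb_bud emb_e) => /bud_stem ->.
by rewrite /is_stem => ->; rewrite (inj_eq (emb_inj emb_e)); apply/negbTE.
Qed.

Lemma emb_surj (x0 : m) : (forall a, is_leaf a -> is_stem (e a)) -> is_iso e.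
Proof.
move=> leaf_stem.
have oppE d : e (opp m d) = opp u (e d).
  have [/leaf_stem sd|/emb_is_stem] := boolP (is_leaf d).
    by have := emb_opp emb_e d; rewrite (eqP sd) codom_f.
  have [sd sed|/emb_nonstem //] := boolP (is_stem d).
  by rewrite (eqP sd) (eqP sed).
have surj y : y \in codom e.
  have /connectP[p] := map_connected (e x0) y.
  have: e x0 \in codom e by apply: codom_f.
  elim: p (e x0) => [x xc _ -> //|z p IHp x xc /= /andP[/orP[]/eqP-> pp]]; apply: IHp => //.
    by rewrite emb_codom_rot.
  by case/codomP: xc => d ->; rewrite -oppE codom_f.
split=> //; last exact: emb_bud; last exact: emb_rot.
by exists (fun y => iinv (surj y)) => [d|y]; rewrite ?f_iinv // iinv_f //; apply: emb_inj.
Qed.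

End EmbeddingTheory.

Lemma iso_embedding (m u : blossoming_map) (e : m -> u) : is_iso e -> embedding e.
Proof.
move=> iso_e; have [[g eK gK] er eo eb] := iso_e.
have surj y : y \in codom e by rewrite -(gK y) codom_f.
split=> //; first exact: iso_inj iso_e.
- by move=> d; rewrite surj.
- by move=> y; rewrite surj.
move=> V /set0Pn[y yV] _ /(_ (g y)); by rewrite gK yV.
Qed.

(** * Embeddings and the expansion of a leaf *)

Section ExpandEmbedding.

Variables (m u : blossoming_map) (a : m).
Hypothesis leaf_a : is_leaf a.

Lemma expand_vertexr b i : vertex_of (inr i : expand b leaf_a) = [set inr j | j : 'I_4].
Proof.
apply/setP=> x; apply/porbitP/imsetP=> [[n ->]|[j _ ->]].
  rewrite permX; elim: n => [|n [j _ IHn]]; first by exists i.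
  by exists (j + 1); rewrite // iterS IHn expand_rotr.
exists (j - i : 'I_4); rewrite permX.
have iterE n : iter n (rot (expand b leaf_a)) (inr i) = inr (i + n%:R).
  by elim: n => [|n IHn]; rewrite ?addr0 // iterS IHn expand_rotr -natr1 addrA.
by rewrite iterE natr_Zp addrC subrK.
Qed.

Lemma expand_prune b : prune_step (expand b leaf_a) m.
Proof.
exists (vertex_of (inr 0 : expand b leaf_a)), inl; rewrite expand_vertexr; split.
- split; first by rewrite -(expand_vertexr b 0); apply: imset_f.
  apply/eqP/cards1P; exists (inr 0); apply/setP=> -[d|i]; rewrite !inE.
    by apply/andP=> -[/imsetP[]].
  by rewrite imset_f // expand_stemr negbK.
- split=> [|[d|i]]; first exact: inl_inj.
    by rewrite codom_f; apply/esym/imsetP=> -[].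
  by rewrite imset_f //; apply/codomP=> -[].
- by move=> d; rewrite expand_rotl.
- move=> d; rewrite expand_oppl; have [->|da] := eqVneq d a.
    by rewrite imset_f // opp_leaf.
  by rewrite ifN //; apply/imsetP=> -[].
by move=> d; rewrite expand_budl.
Qed.

Lemma expand_four_valent b : four_valent m -> four_valent (expand b leaf_a).
Proof.
move=> /forallP m4; apply/forallP=> v; apply/implyP=> /imsetP[[d|i] _ ->].
  have fi n : iter n (rot (expand b leaf_a)) (inl d) = inl (iter n (rot m) d).
    by elim: n => // n IHn; rewrite iterS IHn expand_rotl.
  have -> : porbit (rot (expand b leaf_a)) (inl d) = inl @: porbit (rot m) d.
    apply/setP=> y; apply/porbitP/imsetP=> [[n ->]|[z /porbitP[n ->] ->]].
      by exists (iter n (rot m) d); rewrite ?permX ?fi -?permX ?mem_porbit.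
    by exists n; rewrite !permX fi.
  rewrite /degree card_imset; last exact: inl_inj.
  by have := m4 (porbit (rot m) d); rewrite imset_f.
have := expand_vertexr b i; rewrite /vertex_of /degree => ->.
by rewrite card_imset ?card_ord //; apply: inr_inj.
Qed.

(** For the forest condition, a set reaching outside the larger image is handled by its trace there;
    otherwise it is the new vertex, whose half-edge 0 is its only link. *)
Lemma embedding_restrict b (e : expand b leaf_a -> u) :
  embedding e -> embedding (fun d => e (inl d)).
Proof.
move=> emb_e; have e_inj := emb_inj emb_e.
have codomE y : y \in codom e = (y \in codom (fun d => e (inl d))) || [exists i, y == e (inr i)].
  apply/codomP/orP=> [[[d|i] ->]|[/codomP[d ->]|/existsP[i /eqP->]]].
  - by left; apply: codom_f.
  - by right; apply/existsP; exists i.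
  - by exists (inl d).
  by exists (inr i).
split.
- by move=> d d' eqe; apply: inl_inj (e_inj _ _ eqe).
- by move=> d; rewrite -(emb_rot emb_e) expand_rotl.
- by move=> d; rewrite (emb_bud emb_e) expand_budl.
- move=> d; have [->|da] := eqVneq d a.
    have := emb_nonstem emb_e (d := inl a); rewrite expand_steml eqxx => /(_ isT) ->.
    rewrite expand_oppl eqxx opp_leaf // ifN //.
    by apply/codomP=> -[d' /e_inj].
  have [sd|sd] := boolP (is_stem d).
    have := emb_opp emb_e (inl d); rewrite expand_oppl (negbTE da) codomE (eqP sd).
    by case: ifP => [_ <-|/norP[/negbTE -> _]] //; case: ifP.
  have := emb_nonstem emb_e (d := inl d); rewrite expand_steml da expand_oppl (negbTE da).
  by move=> /(_ sd) ->; rewrite codom_f.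
- move=> y; have [/codomP[[d|i] ->]|yN _] := boolP (y \in codom e).
  + by case/negP; apply: codom_f.
  + move=> _; rewrite (emb_vertex emb_e) expand_vertexr; split.
      by rewrite !card_imset ?card_ord //; apply: inr_inj.
    apply/eqP/cards1P; exists (e (inr (lift ord0 b))).
    apply/setP=> z; rewrite !inE; apply/andP/eqP=> [[/imsetP[_ /imsetP[j _ ->] ->]]|->].
      by rewrite (emb_bud emb_e) expand_budr => /eqP ->.
    by rewrite (emb_bud emb_e) expand_budr eqxx !imset_f.
  exact: (emb_out emb_e).
move=> V V0 VS Vout.
have [/set0Pn V'0|] := boolP (V :\: [set y | y \in codom e] != set0).
  have [|||w] := emb_forest emb_e (V := V :\: [set y | y \in codom e]).
  - exact/set0Pn.
  - by move=> y; rewrite !inE (emb_codom_rot emb_e) => /andP[-> /VS].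
  - by move=> d; rewrite !inE codom_f.
  rewrite !inE => /andP[_ wV] uniq_w; exists w => // z z' zw z'w.
  have link y : linked [predU V & codom (fun d => e (inl d))] y ->
      linked [predU V :\: [set y | y \in codom e] & codom e] y.
    rewrite /linked !inE codomE => /andP[->] /=.
    by case/orP=> ->; case: (_ \in _) => //=; case: [exists _, _].
  by move=> /link lz /link lz'; apply: uniq_w.
rewrite negbK setD_eq0 => /subsetP V_e.
have [y yV] := set0Pn _ V0; exists y => // z z' zy z'y.
suff only0 x : x \in vertex_of y -> linked [predU V & codom (fun d => e (inl d))] x ->
    x = e (inr 0).
  by move=> /(only0 _ zy) -> /(only0 _ z'y) ->.
have := V_e y yV; rewrite inE => /codomP[[d|i] defy]; first by have := Vout d; rewrite -defy yV.
rewrite defy (emb_vertex emb_e) expand_vertexr => /imsetP[_ /imsetP[j _ ->] ->].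
case/andP=> nstem; rewrite !inE => oin.
have {}oin : opp u (e (inr j)) \in codom e.
  by case/orP: oin => [/V_e|]; rewrite ?inE // codomE => ->.
have := emb_opp emb_e (inr j); rewrite oin expand_oppr; have [->//|_] := eqVneq j 0.
by move/esym/eqP=> st; case/negP: nstem.
Qed.

Variable (e : m -> u).
Hypothesis emb_e : embedding e.
Hypothesis nstem_a : ~~ is_stem (e a).

(** The half-edge facing [e a] lies outside the image, so its vertex has degree 4 and one bud, which
    is what [expand] creates; the position of the bud dictates [b]. *)
Lemma embedding_extend :
  exists b (e' : expand b leaf_a -> u), embedding e' /\ forall d, e' (inl d) = e d.
Proof.
set y := opp u (e a).
have yout : y \notin codom e.
  apply/negP=> yin; have := emb_opp emb_e a; rewrite yin opp_leaf // => /esym/eqP st.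
  by move/negP: nstem_a.
have [card_y bud_y] := emb_out emb_e yout.
pose r i := iter i (rot u) y.
have r4 : r 4%N = y by rewrite /r -{1}card_y /vertex_of iter_porbit.
have r_inj (i j : 'I_4) : r i = r j -> i = j.
  have := uniq_traject_porbit (rot u) y; rewrite -/(vertex_of y) card_y => un eq_r.
  apply: val_inj => /=; apply/eqP; rewrite -(nth_uniq y _ _ un) ?size_traject //.
  by rewrite !nth_traject // -/(r i) -/(r j) eq_r.
have r_in i : r i \in vertex_of y by apply/porbitP; exists i; rewrite permX.
have vertexE z : z \in vertex_of y -> exists i : 'I_4, z = r i.
  rewrite /vertex_of porbit_traject -/(vertex_of y) card_y => /trajectP[i lti ->].
  by exists (Ordinal lti).
have vertex_out z : z \in vertex_of y -> z \notin codom e.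
  by case/porbitP=> n ->; rewrite permX; elim: n => //= n; rewrite (emb_codom_rot emb_e).
have vertexS z : z \in vertex_of y -> rot u z \in vertex_of y by apply: vertex_of_rot.
have y_nstem : ~~ is_stem y by rewrite nonstem_opp.
(* The forest condition for this vertex alone excludes a loop at it and a second edge to the
   image. *)
have only_y z : z \in vertex_of y -> ~~ is_stem z ->
    (opp u z \in vertex_of y) || (opp u z \in codom e) -> z = y.
  have [|||w wy uniq_w] := emb_forest emb_e (V := vertex_of y).
  - by apply/set0Pn; exists y; apply: (r_in 0%N).
  - exact: vertexS.
  - by move=> d; apply/negP=> /vertex_out; rewrite codom_f.
  have wE : vertex_of w = vertex_of y by apply/eqP; rewrite eq_porbit_mem.
  move=> zy zs zo; apply: uniq_w; rewrite ?wE ?(r_in 0%N) // /linked !inE ?zs //.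
  by rewrite y_nstem oppK codom_f orbT.
have [b budb] : exists b : 'I_3, forall i : 'I_4, (r i \in bud u) = (i == lift ord0 b).
  have /eqP/cards1P[w defw] := bud_y.
  have : w \in vertex_of y :&: bud u by rewrite defw inE.
  rewrite inE => /andP[wy wb]; have [i defi] := vertexE w wy.
  have [b defb|i0] := unliftP ord0 i; last first.
    by have := bud_stem wb; rewrite defi i0 (negbTE y_nstem).
  exists b => j; apply/idP/eqP=> [bj|->]; last by rewrite -defb -defi.
  apply: r_inj; rewrite -defb -defi; apply/eqP; rewrite -in_set1 -defw inE bj andbT; exact: r_in.
pose e' (x : expand b leaf_a) := match x with inl d => e d | inr i => r i end.
have codomE z : (z \in codom e') = (z \in codom e) || (z \in vertex_of y).
  apply/codomP/orP=> [[[d|i] ->]|[/codomP[d ->]|/vertexE[i ->]]].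
  - by left; apply: codom_f.
  - by right; apply: r_in.
  - by exists (inl d).
  by exists (inr i).
exists b, e'; split=> //; split.
- move=> [d|i] [d'|j] /= eqe.
  + by congr inl; apply: (emb_inj emb_e).
  + by have := vertex_out _ (r_in j); rewrite -eqe codom_f.
  + by have := vertex_out _ (r_in i); rewrite eqe codom_f.
  by congr inr; apply: r_inj.
- move=> [d|i]; rewrite ?expand_rotl ?expand_rotr /=; first exact: emb_rot.
  by elim/ord4_ind: i => //=; rewrite -/(r 4%N) r4.
- by move=> [d|i]; rewrite ?expand_budl ?expand_budr -?budb // /e' (emb_bud emb_e).
- move=> [d|i]; rewrite ?expand_oppl ?expand_oppr codomE.
    have [->|da] := eqVneq d a; first by rewrite /= -/y (r_in 0%N) orbT.
    rewrite /= (emb_opp emb_e); case: ifP => //= _; case: ifP => // oy.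
    have := only_y _ oy; rewrite nonstem_opp oppK codom_f orbT.
    have [/eqP->//|_ /(_ isT isT)] := boolP (is_stem (e d)).
    by move/(@perm_inj _ (opp u))/(emb_inj emb_e)/eqP; rewrite (negbTE da).
  have [->|i0] := eqVneq i 0; first by rewrite /= oppK codom_f.
  rewrite /=; case: ifP => // oin; have [/eqP-> //|si] := boolP (is_stem (r i)).
  have := only_y _ (r_in i) si; rewrite orbC oin => /(_ isT) /(r_inj i 0) eqi.
  by rewrite eqi eqxx in i0.
- by move=> z; rewrite codomE => /norP[+ _]; apply: (emb_out emb_e).
move=> V V0 VS Vout; have VC z : z \in V -> (z \notin codom e) && (z \notin vertex_of y).
  by move=> zV; rewrite -negb_or -codomE; apply/negP=> /codomP[x defz]; have := Vout x; rewrite -defz zV.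
(* If [V] is joined to the new vertex, the old forest condition is applied to their union. Its
   witness cannot be the new vertex, which is linked both to [e a] and to [V], so it lies in [V]. *)
have [/existsP[v /andP[vV ovy]]|] := boolP [exists v, (v \in V) && (opp u v \in vertex_of y)].
  have [|||w] := emb_forest emb_e (V := V :|: vertex_of y).
  - by apply/set0Pn; exists v; rewrite inE vV.
  - by move=> z; rewrite !inE => /orP[/VS->//|/vertexS->]; rewrite orbT.
  - move=> d; rewrite inE; apply/negP=> /orP[/VC|/vertex_out]; by rewrite codom_f.
  have linkE z : linked [predU V & codom e'] z -> linked [predU V :|: vertex_of y & codom e] z.
    by rewrite /linked !inE codomE -orbA [_ || (_ \in codom e)]orbC.
  rewrite inE => /orP[wV|wy] uniq_w.
    by exists w => // z z' zw z'w /linkE lz /linkE lz'; apply: uniq_w.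
  have wE : vertex_of w = vertex_of y by apply/eqP; rewrite eq_porbit_mem.
  have vs : ~~ is_stem v.
    by apply/negP=> /eqP ov; move: ovy; rewrite ov; apply/negP; case/andP: (VC _ vV).
  have := uniq_w y (opp u v); rewrite wE (r_in 0%N) ovy /linked !inE nonstem_opp y_nstem vs !oppK.
  rewrite vV codom_f orbT => /(_ isT isT isT isT) /perm_inj eqv.
  by have := VC _ vV; rewrite -eqv codom_f.
rewrite negb_exists => /forallP noy.
have [|w wV uniq_w] := emb_forest emb_e V0 VS.
  by move=> d; apply/negP=> /VC; rewrite codom_f.
exists w => // z z' zw z'w.
have linkE x : x \in vertex_of w -> linked [predU V & codom e'] x -> linked [predU V & codom e] x.
  move=> xw; have := noy x; rewrite (stable_vertex VS wV xw) /linked !inE codomE /=.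
  by move=> /negbTE ->; rewrite orbF.
by move=> /(linkE _ zw) lz /(linkE _ z'w) lz'; apply: uniq_w.
Qed.

End ExpandEmbedding.

(** * Growing and pruning *)

(** Expanding leaves of [m] one at a time until [e] becomes an isomorphism carries the labelling,
    the degrees and the pruning outwards; the number of half-edges missed by [e] decreases. *)
Lemma embedding_grow (m u : blossoming_map) (e : m -> u) (x0 : m) :
    embedding e -> labelled x0 -> four_valent m ->
  [/\ labelled (e x0), four_valent u & forall c, pruned_to m c -> pruned_to u c].
Proof.
have [n] := ubnP (#|u| - #|m|)%N; elim: n m e x0 => // n IHn m e x0 ltn emb_e lab_m m4.
have [/existsP[a /andP[leaf_a nst]]|] := boolP [exists a, is_leaf a && ~~ is_stem (e a)].
  have [b [e' [emb_e' e'E]]] := embedding_extend leaf_a emb_e nst.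
  have cardE : #|expand b leaf_a| = (#|m| + 4)%N by rewrite [LHS](card_sum m 'I_4) card_ord.
  have := leq_card _ (emb_inj emb_e'); rewrite cardE => le_u.
  have [lab_e _] := expand_labelled_lab b leaf_a lab_m.
  have [] := IHn _ e' (inl x0) _ emb_e' lab_e (expand_four_valent leaf_a b m4).
    by rewrite cardE; lia.
  rewrite e'E => lab_u u4 pr; split=> // c prc; apply: pr.
  exact: PrunedStep (expand_prune leaf_a b) prc.
rewrite negb_exists => /forallP all_stem.
have iso_e : is_iso e.
  apply: (emb_surj emb_e x0) => a leaf_a.
  by have := all_stem a; rewrite leaf_a /= negbK.
have [lab_u _] := iso_labelled iso_e lab_m; split=> // [|c prc].
  have [[g eK gK] _ _ _] := iso_e.
  apply/forallP=> v; apply/implyP=> /imsetP[y _ ->].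
  rewrite -/(vertex_of y) -(gK y) (iso_vertex iso_e) /degree card_imset; last exact: iso_inj iso_e.
  by have /forallP/(_ (vertex_of (g y))) := m4; rewrite imset_f //= => /eqP.
by apply: pruned_to_iso prc _; exists e.
Qed.

Section Prune.

Variables (m m' : blossoming_map) (v : {set m}) (f : m' -> m) (x0 : m').
Hypothesis v_vertex : v \in vertices m.
Hypothesis v_deg1 : interior_degree v = 1%N.
Hypothesis f_inj : injective f.
Hypothesis f_codom : forall d, (d \in codom f) = (d \notin v).
Hypothesis f_rot : forall d, f (rot m' d) = rot m (f d).
Hypothesis f_opp : forall d, f (opp m' d) = if opp m (f d) \in v then f d else opp m (f d).
Hypothesis f_bud : forall d, (d \in bud m') = (f d \in bud m).
Hypothesis m4 : four_valent m.
Hypothesis lab_m : labelled (f x0).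

Lemma f_notin d : f d \notin v.
Proof. by rewrite -f_codom codom_f. Qed.

Lemma prune_vertex d : vertex_of (f d) = f @: vertex_of d.
Proof.
have fi n x : f (iter n (rot m') x) = iter n (rot m) (f x).
  by elim: n => //= n <-; rewrite f_rot.
apply/setP=> y; apply/porbitP/imsetP=> [[i ->]|[z /porbitP[i ->] ->]].
  exists (iter i (rot m') d); last by rewrite permX fi.
  by apply/porbitP; exists i; rewrite permX.
by exists i; rewrite !permX fi.
Qed.

Lemma card_vertex (y : m) : #|vertex_of y| = 4%N.
Proof. by have /forallP/(_ (vertex_of y)) := m4; rewrite imset_f //= => /eqP. Qed.

Lemma prune_four_valent : four_valent m'.
Proof.
apply/forallP=> w; apply/implyP=> /imsetP[d _ ->].
by rewrite /degree -(card_imset _ f_inj) -/(vertex_of d) -prune_vertex card_vertex.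
Qed.

(** Here [y] is the half at [v] of its only edge and [f a] is the opposite half, so [a] is the
    half-edge that becomes a leaf. *)
Lemma prune_half_edge : exists y a,
  [/\ v = vertex_of y, ~~ is_stem y, forall z, z \in v -> ~~ is_stem z -> z = y,
      opp m y = f a & forall d, (opp m (f d) \in v) = (d == a)].
Proof.
have /eqP/cards1P[y defy] := v_deg1.
have only_y z : z \in v -> ~~ is_stem z -> z = y.
  by move=> zv zs; apply/eqP; rewrite -in_set1 -defy inE zv.
have : y \in [set d in v | ~~ is_stem d] by rewrite defy inE.
rewrite inE => /andP[yv ys].
have oyv : opp m y \notin v.
  apply/negP=> /only_y; rewrite nonstem_opp => /(_ ys) st.
  by rewrite /is_stem st eqxx in ys.
have /codomP[a defa] : opp m y \in codom f by rewrite f_codom.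
exists y, a; split=> //.
  have /imsetP[z _ defv] := v_vertex; rewrite defv in yv *.
  by apply/eqP; rewrite eq_sym eq_porbit_mem.
move=> d; apply/idP/eqP=> [odv|->]; last by rewrite -defa oppK.
apply: f_inj; rewrite -defa -(only_y _ odv) ?oppK // nonstem_opp.
apply/negP=> /eqP st; by have := f_notin d; rewrite -st odv.
Qed.

(** The contour enters [v] from [f a], crosses three stems and leaves through [y]. By the edge rule
    this excursion lowers the label by exactly 1, so the stems are one bud and two leaves, and a
    single leaf in place of [v] alters no other label. *)
Lemma prune_labelled : labelled x0 /\ #|v :&: bud m| = 1%N.
Proof.
have [y [a [defv ys only_y oy oa]]] := prune_half_edge.
have yv : y \in v by rewrite defv /vertex_of porbit_id.
have [t_inj h0 tS hS hE] := lab_m; set t := findex _ _ in t_inj tS hE.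
pose r i := iter i (rot m) y.
have r4 : r 4%N = y by rewrite /r -{1}(card_vertex y) /vertex_of iter_porbit.
have rv i : r i \in v by rewrite defv; apply/porbitP; exists i; rewrite permX.
have r_neq i : (r i == f x0) = false by apply/eqP=> eqr; have := f_notin x0; rewrite -eqr rv.
have r_neq_y i : (0 < i < 4)%N -> r i != y.
  have := uniq_traject_porbit (rot m) y; rewrite -/(vertex_of y) card_vertex.
  rewrite /= !inE -/(r 1%N) -/(r 2%N) -/(r 3%N) !negb_or => /andP[/and3P[n1 n2 n3] _].
  by case: i => [|[|[|[|i]]]] // _; rewrite eq_sym.
have r_stem i : (0 < i < 4)%N -> is_stem (r i).
  by move=> /r_neq_y; apply: contraNT => nst; apply/eqP; apply: only_y.
have c0 : contour m (f a) = r 1%N by rewrite contourE -oy oppK.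
have cr i : (0 < i < 4)%N -> contour m (r i) = r i.+1.
  by move=> /r_stem/eqP st; rewrite contourE st.
have c4 : contour m y = rot m (f a) by rewrite contourE oy.
have as_ : ~~ is_stem (f a) by rewrite -oy nonstem_opp.
have ta : (t (f a) < t (r 1%N))%N by rewrite -c0; apply: tS; rewrite c0 r_neq.
have tr i : (0 < i < 4)%N -> (t (r i) < t (r i.+1))%N.
  by move=> lti; rewrite -cr //; apply: tS; rewrite cr // r_neq.
have ty : (t (f a) < t y)%N.
  by have := tr 1%N isT; have := tr 2%N isT; have := tr 3%N isT; rewrite r4; lia.
have hy : lab (f x0) y = lab (f x0) (f a) - 1.
  by have := hE _ as_; rewrite -oy oppK; apply; rewrite oy.
have hr i : (0 < i < 4)%N -> lab (f x0) (r i.+1) = lab (f x0) (r i) + weight (r i).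
  by move=> lti; rewrite -cr // hS cr // r_neq addr0.
have sum_r : weight (r 1%N) + weight (r 2%N) + weight (r 3%N) = -1.
  have := hr 1%N isT; have := hr 2%N isT; have := hr 3%N isT; rewrite r4 hy.
  have := hS (f a); rewrite c0 r_neq {1}/weight as_ /=; lia.
have fc d : f (contour m' d) = if d == a then rot m (f d) else contour m (f d).
  by rewrite !contourE f_rot f_opp oa; case: ifP.
have stem_f d : is_stem d = (d == a) || is_stem (f d).
  by rewrite /is_stem -(inj_eq f_inj) f_opp oa; case: ifP; rewrite ?eqxx.
have wf d : weight d = if d == a then -1 else weight (f d).
  rewrite /weight stem_f f_bud; case: eqP => // ->.
  by rewrite ifN //; apply: contra as_ => /bud_stem.
split; last first.
  apply/eqP/cards1P.
  have wr i : (0 < i < 4)%N -> weight (r i) = if r i \in bud m then 1 else -1.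
    by move=> /r_stem st; rewrite /weight st.
  have vE z : (z \in v) = [|| z == y, z == r 1%N, z == r 2%N | z == r 3%N].
    by rewrite defv /vertex_of porbit_traject -/(vertex_of y) card_vertex /= !inE.
  have yb : y \notin bud m by apply: contra ys => /bud_stem.
  have only i : (0 < i < 4)%N -> r i \in bud m ->
      (forall j, (0 < j < 4)%N -> j != i -> r j \notin bud m) -> v :&: bud m = [set r i].
    move=> lti bi bj; apply/setP=> z; rewrite !inE vE; apply/andP/eqP=> [[]|->]; last first.
      by split=> //; case: i lti {bi bj} => [|[|[|[|i]]]] //=; rewrite eqxx ?orbT.
    case/or4P=> /eqP-> // zb; first by rewrite zb in yb.
    - by case: (eqVneq 1%N i) => [->//|n1]; have := bj 1%N isT n1; rewrite zb.
    - by case: (eqVneq 2%N i) => [->//|n1]; have := bj 2%N isT n1; rewrite zb.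
    by case: (eqVneq 3%N i) => [->//|n1]; have := bj 3%N isT n1; rewrite zb.
  move: sum_r; rewrite !wr //.
  have [b1|b1] := ifPn; have [b2|b2] := ifPn; have [b3|b3] := ifPn => // _.
  - exists (r 1%N); apply: only => // -[|[|[|[|j]]]] //.
  - exists (r 2%N); apply: only => // -[|[|[|[|j]]]] //.
  - exists (r 3%N); apply: only => // -[|[|[|[|j]]]] //.
(* The old times and labels restrict to the remaining half-edges. *)
suff th : labelling x0 (t \o f) (lab (f x0) \o f) by apply: labelling_labelled th.
split=> /=; first exact: inj_comp.
- exact: h0.
- move=> d; rewrite -(inj_eq f_inj) fc; have [->|_ neq] := eqVneq d a; last exact: tS.
  by rewrite -c4 => neq; apply: ltn_trans ty _; apply: tS.
- move=> d; rewrite fc wf -[contour m' d == _](inj_eq f_inj) fc; have [->|da] := eqVneq d a.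
    by rewrite -c4 hS hy {1}/weight ys /=; lia.
  by rewrite hS.
move=> d; rewrite stem_f negb_or => /andP[/negbTE da ds]; rewrite f_opp oa da; exact: hE.
Qed.

Lemma prune_embedding (c : blossoming_map) (e : c -> m') :
  embedding e -> embedding (fun d => f (e d)).
Proof.
move=> emb_e; have [y [a [defv ys only_y oy oa]]] := prune_half_edge.
have [_ v_bud] := prune_labelled.
have codomE z : (f z \in codom (fun d => f (e d))) = (z \in codom e).
  apply/codomP/codomP=> [[d /f_inj ->]|[d ->]]; by exists d.
have codomN z : z \in v -> z \notin codom (fun d => f (e d)).
  by move=> zv; apply/codomP=> -[d defz]; have := f_notin (e d); rewrite -defz zv.
split.
- by move=> d d' /f_inj/(emb_inj emb_e).
- by move=> d; rewrite (emb_rot emb_e) f_rot.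
- by move=> d; rewrite -f_bud (emb_bud emb_e).
- move=> d; have := f_opp (e d); rewrite (emb_opp emb_e).
  case: ifP => [ov eqf|_ eqf].
    by rewrite (negbTE (codomN _ ov)); case: ifP.
  by rewrite -eqf codomE; case: ifP.
- move=> z zN; have [zv|] := boolP (z \in v).
    have -> : vertex_of z = v.
      by have /imsetP[x _ defx] := v_vertex; rewrite defx in zv *; apply/eqP; rewrite eq_porbit_mem.
    by rewrite v_bud defv card_vertex.
  rewrite -f_codom => /codomP[w defw]; rewrite defw codomE in zN *.
  have [cw bw] := emb_out emb_e zN; rewrite prune_vertex card_imset //; split=> //.
  rewrite -bw -[RHS](card_imset _ f_inj); apply: eq_card => x; rewrite !inE.
  apply/andP/imsetP=> [[/imsetP[d dw ->]]|[d]].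
    by rewrite -f_bud => db; exists d; rewrite ?inE ?dw.
  by rewrite inE => /andP[dw db] ->; rewrite imset_f -?f_bud.
move=> V V0 VS Vout.
(* A set meeting [v] is settled by [v] itself, which has a single edge; any other set lies in the
   image of [f], where the condition for [e] applies. *)
have [/existsP[w /andP[wV wv]]|] := boolP [exists w, (w \in V) && (w \in v)].
  exists w => // z z'; have -> : vertex_of w = v.
    by have /imsetP[x _ defx] := v_vertex; rewrite defx in wv *; apply/eqP; rewrite eq_porbit_mem.
  move=> zv z'v; rewrite /linked => /andP[zs _] /andP[z's _].
  by rewrite (only_y z zv zs) (only_y z' z'v z's).
rewrite negb_exists => /forallP Vv.
have V_codom z : z \in V -> exists x, z = f x.
  by move=> zV; apply/codomP; rewrite f_codom; have := Vv z; rewrite zV.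
have [|||w] := emb_forest emb_e (V := f @^-1: V).
- have [z zV] := set0Pn _ V0; have [x defx] := V_codom z zV.
  by apply/set0Pn; exists x; rewrite inE -defx.
- by move=> x; rewrite !inE f_rot => /VS.
- by move=> d; rewrite inE.
rewrite inE => wV uniq_w; exists (f w) => // z z'.
rewrite prune_vertex => /imsetP[x xw ->] /imsetP[x' x'w ->].
have link t : linked [predU V & codom (fun d => f (e d))] (f t) ->
    linked [predU f @^-1: V & codom e] t.
  rewrite /linked !inE => /andP[ts ot].
  have otv : opp m (f t) \notin v.
    case/orP: ot => [oV|]; first by have := Vv (opp m (f t)); rewrite oV.
    by apply: contraL => /codomN.
  have := f_opp t; rewrite (negbTE otv) => fo; rewrite fo.
  move: ot; rewrite -fo codomE => ->; rewrite andbT.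
  by apply: contra ts => /eqP st; rewrite /is_stem -fo st.
by move=> /link lx /link lx'; rewrite (uniq_w x x').
Qed.

End Prune.

(** A pruning step may delete the base corner, so the base is first moved to a surviving one; this
    is why the existence of a half-edge is carried through the induction. *)
Lemma pruned_embedding m c : pruned_to m c -> forall y : c,
  (exists z : m, True) /\ (forall x : m, labelled x -> four_valent m -> exists e : c -> m, embedding e).
Proof.
elim=> {m c} [m c _ mc y|m m' c [v [f [[vm v1] [f_inj fcod] fr fo fb]]] _ IH y].
  have [g iso_g] := map_iso_sym mc; split; first by exists (g y).
  by move=> x _ _; exists g; apply: iso_embedding.
have [[z _] IHe] := IH y; split=> [|x lab_x m4]; first by exists (f z).
have [lab_z _] := labelled_change_base (f z) lab_x.
have [lab_z' _] := prune_labelled vm v1 f_inj fcod fr fo fb m4 lab_z.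
have [e emb_e] := IHe z lab_z' (prune_four_valent f_inj fr m4).
exists (fun d => f (e d)).
exact: (prune_embedding vm v1 f_inj fcod fr fo fb m4 lab_z emb_e).
Qed.

(** The part of the second copy outside the first would be a set of vertices each having two edges
    that lead back to this part or to the first copy, against the forest condition. *)
Lemma embedding_codom (c u : blossoming_map) (e e' : c -> u) :
    (forall v, v \in vertices c -> (2 <= interior_degree v)%N) ->
  embedding e -> embedding e' -> forall d, e' d \in codom e.
Proof.
move=> c2 emb_e emb_e'.
suff V0 : [set y in codom e' | y \notin codom e] = set0.
  move=> d; apply/negPn/negP=> dN.
  by have := in_set0 (e' d); rewrite -V0 inE codom_f dN.
apply/eqP/negPn/negP=> V0.
have [||w] := emb_forest emb_e V0.
- by move=> y; rewrite !inE !(emb_codom_rot emb_e) !(emb_codom_rot emb_e').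
- by move=> d; rewrite inE codom_f andbF.
rewrite inE => /andP[/codomP[d ->] _] uniq_d.
have /card_gt1P[z [z' []]] := c2 (vertex_of d) (imset_f _ isT).
rewrite !inE => /andP[zd zs] /andP[z'd z's] /eqP; apply; apply: (emb_inj emb_e').
have link x : ~~ is_stem x ->
    linked [predU [set y in codom e' | y \notin codom e] & codom e] (e' x).
  move=> xs; rewrite /linked /is_stem (emb_nonstem emb_e') // (inj_eq (emb_inj emb_e')).
  by rewrite xs /= !inE codom_f; case: (_ \in _).
by apply: uniq_d; rewrite ?(emb_vertex emb_e') ?imset_f // link.
Qed.

Lemma embedding_unique (c u : blossoming_map) (e e' : c -> u) :
    (forall v, v \in vertices c -> (2 <= interior_degree v)%N) ->
  embedding e -> embedding e' -> exists2 phi : c -> c, is_iso phi & forall d, e' d = e (phi d).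
Proof.
move=> c2 emb_e emb_e'.
have in_e := embedding_codom c2 emb_e emb_e'; have in_e' := embedding_codom c2 emb_e' emb_e.
pose phi d := iinv (in_e d); have phiE d : e (phi d) = e' d by apply: f_iinv.
have codomE y : (y \in codom e) = (y \in codom e') by apply/codomP/codomP=> -[d ->]; apply/codomP.
have e_inj := emb_inj emb_e; exists phi => //; split.
- by apply: injF_bij => d d' /(congr1 e); rewrite !phiE => /(emb_inj emb_e').
- by move=> d; apply: e_inj; rewrite phiE (emb_rot emb_e) phiE (emb_rot emb_e').
- move=> d; apply: e_inj; rewrite phiE (emb_opp emb_e) phiE (emb_opp emb_e').
  by rewrite codomE.
by move=> d; rewrite -(emb_bud emb_e) phiE (emb_bud emb_e').
Qed.

Lemma embedding_comp_iso (c c' u : blossoming_map) (e : c -> u) (phi : c' -> c) :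
  embedding e -> is_iso phi -> embedding (fun d => e (phi d)).
Proof.
move=> emb_e iso_phi; have [[g phiK gK] pr po pb] := iso_phi.
have codomE y : (y \in codom (fun d => e (phi d))) = (y \in codom e).
  by apply/codomP/codomP=> -[d ->]; [exists (phi d)|exists (g d); rewrite gK].
split.
- by move=> d d' /(emb_inj emb_e)/(iso_inj iso_phi).
- by move=> d; rewrite pr (emb_rot emb_e).
- by move=> d; rewrite (emb_bud emb_e) pb.
- by move=> d; rewrite po (emb_opp emb_e) codomE.
- by move=> y; rewrite codomE; apply: emb_out.
move=> V V0 VS Vout.
have [|w wV uniq_w] := emb_forest emb_e V0 VS; first by move=> d; rewrite -(gK d).
by exists w => // z z' zw z'w; rewrite /linked !inE !codomE; apply: uniq_w.
Qed.

Lemma iso_comp_embedding (c u u' : blossoming_map) (e : c -> u) (f : u -> u') :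
  embedding e -> is_iso f -> embedding (fun d => f (e d)).
Proof.
move=> emb_e iso_f; have [[g fK gK] fr fo fb] := iso_f; have f_inj := iso_inj iso_f.
have codomE y : (f y \in codom (fun d => f (e d))) = (y \in codom e).
  by apply/codomP/codomP=> -[d]; [move/f_inj->|move->]; exists d.
split.
- by move=> d d' /f_inj/(emb_inj emb_e).
- by move=> d; rewrite (emb_rot emb_e) fr.
- by move=> d; rewrite fb (emb_bud emb_e).
- by move=> d; rewrite (emb_opp emb_e) -fo codomE; case: ifP.
- move=> y; rewrite -(gK y) codomE => /(emb_out emb_e)[cy by_].
  rewrite (iso_vertex iso_f) card_imset //; split=> //.
  rewrite -by_ -[RHS](card_imset _ f_inj); apply: eq_card => x; rewrite !inE.
  apply/andP/imsetP=> [[/imsetP[d dw ->]]|[d]].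
    by rewrite fb => db; exists d; rewrite ?inE ?dw.
  by rewrite inE => /andP[dw db] ->; rewrite imset_f ?fb.
move=> V /set0Pn[y yV] VS Vout.
have [|||w] := emb_forest emb_e (V := f @^-1: V).
- by apply/set0Pn; exists (g y); rewrite inE gK.
- by move=> x; rewrite !inE fr => /VS.
- by move=> d; rewrite inE.
rewrite inE => wV uniq_w; exists (f w) => // z z'.
rewrite (iso_vertex iso_f) => /imsetP[x xw ->] /imsetP[x' x'w ->].
have link t : linked [predU V & codom (fun d => f (e d))] (f t) ->
    linked [predU f @^-1: V & codom e] t.
  by rewrite /linked (iso_stem iso_f) -fo !inE codomE.
by move=> /link lx /link lx'; rewrite (uniq_w x x').
Qed.

(** * The cycle lemma *)

Lemma lab_contour_connect (m : blossoming_map) (x0 : m) :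
    (forall d, fconnect (contour m) x0 d) -> forall d, contour m d != x0 ->
  lab x0 (contour m d) = lab x0 d + weight d.
Proof.
move=> conn d neq0; rewrite /lab findex_contour_connect // big_ord_recr /=.
by rewrite iter_findex.
Qed.

Definition colored_leaves (m : blossoming_map) (x0 : m) (b : bool) : nat :=
  #|[set d : m | is_leaf d && (odd `|lab x0 d|%N == b)]|.

(** Labels based at [s] and at [x0] differ by [lab x0 s] up to an even number. *)
Lemma colored_leaves_base (m : blossoming_map) (x0 s : m) b : labelled x0 ->
  colored_leaves s b = colored_leaves x0 (b (+) odd `|lab x0 s|%N).
Proof.
move=> lab_m; have [_ labE] := labelled_change_base s lab_m.
apply: eq_card => d; rewrite !inE; congr (_ && _); rewrite labE.
by case: b; case: ifP => _; apply/eqP/eqP => /=; lia.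
Qed.

Lemma iso_colored_leaves (m m' : blossoming_map) (f : m -> m') (x0 : m) b :
  is_iso f -> labelled x0 -> colored_leaves (f x0) b = colored_leaves x0 b.
Proof.
move=> iso_f lab_m; have [_ labE] := iso_labelled iso_f lab_m.
rewrite /colored_leaves -(card_imset _ (iso_inj iso_f)); apply: eq_card => y.
have [[g fK gK] _ _ _] := iso_f.
rewrite -(gK y) mem_imset; last exact: iso_inj iso_f.
by rewrite !inE (iso_leaf iso_f) labE.
Qed.

Section GoodRoot.

Variables (u : blossoming_map) (x0 : u).
Hypothesis lab_u : labelled x0.

Local Notation t := (findex (contour u) x0).
Local Notation h := (lab x0).

(** With the root bud counted as a leaf, labels lie 2 below those of the rooted map except at the
    root corner; the bound -2 therefore expresses nonnegativity. *)
Definition good_leaf (s : u) : Prop := is_leaf s /\ forall d, -2 <= lab s d.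

Lemma good_leafP s : good_leaf s <-> is_leaf s /\
  forall d, h s <= h d + (if (t d < t s)%N then 0 else 2).
Proof.
have [_ labE] := labelled_change_base s lab_u.
by split=> -[ls hs]; split=> // d; have := hs d; rewrite labE; case: ifP; lia.
Qed.

(** Labels start at 0 and decrease by at most 1 per step, and only across leaves; the step that
    first goes below [v] thus crosses a leaf labelled [v]. *)
Lemma first_passage (v : int) : v <= 0 -> (exists d, h d <= v - 1) ->
  exists s, [/\ is_leaf s, h s = v & forall d, (t d <= t s)%N -> v <= h d].
Proof.
move=> v0 [d0 hd0]; pose P d := h d <= v - 1.
have [d Pd min_d] := @arg_minnP _ d0 P t hd0.
have d_neq : d != x0 by apply: contraTneq Pd => ->; rewrite /P lab0; lia.
set s := (contour u)^-1%g d; have cs : contour u s = d by rewrite permKV.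
have ts : t d = (t s).+1 by rewrite -{1}cs (findex_contourS lab_u) // cs.
have before e : (t e <= t s)%N -> v <= h e.
  move=> le_es; rewrite leNgt; apply/negP=> he.
  have : (t d <= t e)%N by apply: min_d; rewrite /P; lia.
  by rewrite ts; lia.
have hd : h d = h s + weight s by rewrite -{1}cs (labS lab_u) cs (negbTE d_neq) addr0.
have := before s (leqnn _); have := weight_geN1 s; move: Pd; rewrite /P => *.
exists s; split=> //; last lia.
by apply: weight_eqN1; lia.
Qed.

(** The leaf of the first descent to the least label is good, and so is the leaf of the first
    descent to the value just above it, which has the other parity. *)
Lemma good_leaf_exists (b : bool) : exists2 s, good_leaf s & odd `|h s|%N = b.
Proof.
have [z cz] : exists z, contour u z = x0 by exists ((contour u)^-1%g x0); rewrite permKV.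
have hz : h z + weight z = -2.
  by have := labS lab_u z; rewrite cz eqxx lab0; lia.
have [d0 _ min_h] := @arg_minP _ _ _ x0 predT h isT.
have wz := weight_geN1 z; have h0 := min_h z isT.
have : h d0 <= -1 by move: h0; lia.
move=> hd0.
have [||s [ls hs before]] := @first_passage (h d0 + 1); [lia|by exists d0; lia|].
have good_s : good_leaf s.
  apply/good_leafP; split=> // d; have := min_h d isT; have := before d.
  by case: ltnP => [/ltnW lt /(_ lt)|_ _]; lia.
have [<-|pb] := eqVneq (odd `|h s|%N) b; first by exists s.
have [hd2|hd1] := leP (h d0) (-2).
  have [||s' [ls' hs' before']] := @first_passage (h d0 + 2); [lia|by exists d0; lia|].
  exists s'; last by move: pb; rewrite hs hs'; case: b => /eqP; lia.
  apply/good_leafP; split=> // d; have := min_h d isT; have := before' d.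
  by case: ltnP => [/ltnW lt /(_ lt)|_ _]; lia.
(* Here the least label is -1 and, labels starting at 0, [first_passage] gives no descent from 1.
   The last corner of the turn, forced to be a leaf labelled -1, supplies the other parity. *)
exists z; last by move: pb; rewrite hs; case: b => /eqP; lia.
apply/good_leafP; split; first by apply: weight_eqN1; lia.
by move=> d; have := min_h d isT; case: ifP; lia.
Qed.

(** If [s] comes first, goodness of both and equal parity force [h s' = h s - 2]; crossing the leaf
    [s'] then leads 3 below [s], more than a good leaf allows. When this crossing ends the turn,
    comparing [s] with [x0] gives the contradiction. *)
Lemma good_leaf_unique s s' : good_leaf s -> good_leaf s' ->
  odd `|h s|%N = odd `|h s'|%N -> s = s'.
Proof.
wlog ltss : s s' / (t s < t s')%N => [wlog_lt|].
  have [t_inj _ _ _ _] := lab_u.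
  have [lt|lt|/t_inj //] := ltngtP (t s) (t s'); first exact: wlog_lt.
  by move=> gs gs' /esym eqp; apply/esym/wlog_lt.
move=> /good_leafP[ls hs] /good_leafP[ls' hs'] eqp; exfalso.
have cs0 : contour u s != x0.
  by apply/eqP=> /(findex_contour_last lab_u) /(_ s'); lia.
have tc := findex_contourS lab_u cs0; have hc := labS lab_u s.
rewrite (negbTE cs0) weight_leaf // addr0 in hc.
have tcs : (t (contour u s) < t s')%N.
  rewrite ltn_neqAle tc ltss andbT -tc; apply/eqP; case: lab_u => t_inj _ _ _ _ /t_inj eqs.
  by move: eqp; rewrite -eqs hc; lia.
have := hs' (contour u s); rewrite tcs; have := hs s'; rewrite ltnNge (ltnW ltss) /= hc.
move=> h1 h2; have hs2 : h s' = h s - 2 by lia.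
have hc' := labS lab_u s'; rewrite weight_leaf // in hc'.
have [c0|cs0'] := eqVneq (contour u s') x0.
  rewrite c0 eqxx lab0 in hc'; have [eqs|neqs] := eqVneq s x0.
    by have := lab0 s; rewrite {1}eqs; lia.
  by have := hs x0; rewrite lab0 findex0 lt0n findex_eq0 eq_sym neqs; lia.
rewrite (negbTE cs0') addr0 in hc'; have := hs (contour u s').
by rewrite (findex_contourS lab_u cs0') ltnNge (leqW (ltnW ltss)) /= hc'; lia.
Qed.

End GoodRoot.

(** * Rooted maps *)

Definition unroot_root (o : rooted_map) : unroot o := root o.

Section Rooted.

Variable o : rooted_map.

Local Notation u := (unroot o).
Local Notation s := (unroot_root o).
Local Notation t := (findex (contour u) s).

Lemma unroot_root_stem : is_stem s.
Proof. exact: bud_stem (root_is_bud o). Qed.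

Lemma unroot_root_leaf : is_leaf s.
Proof. by rewrite /is_leaf unroot_root_stem !inE eqxx. Qed.

Lemma unroot_leaf (d : u) : is_leaf d = is_leaf (d : o) || (d == s).
Proof.
have [->|ds] := eqVneq d s; first by rewrite orbT unroot_root_leaf.
by rewrite /is_leaf !inE -/(unroot_root o) ds orbF.
Qed.

Lemma label_incrementE (d : o) :
  label_increment d = @weight u d + (if d == s then 2 else 0).
Proof.
rewrite /label_increment /weight !inE -[is_stem (d : u)]/(is_stem (d : o)) -/(unroot_root o).
have [->|_] := eqVneq d s; last by rewrite addr0.
by rewrite [is_stem _]unroot_root_stem [_ \in bud o]root_is_bud.
Qed.

(** The root is crossed at once, and from then on it has contributed 1 instead of -1. *)
Lemma corner_labelE (d : o) : fconnect (contour u) s d ->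
  corner_label d = @lab u s d + (if d == s then 0 else 2).
Proof.
move=> sd; rewrite /corner_label /contour_time -/u -/s.
under eq_bigr do rewrite label_incrementE; rewrite big_split /=; congr (_ + _).
have := findex_eq0 (contour u) s d; have := findex_max sd.
rewrite (eq_sym s) => ltd <-; case defk: (findex _ _ _) ltd => [|k] ltd; first by rewrite big_ord0.
rewrite big_ord_recl /= eqxx big1 ?addr0 // => i _.
case: eqP => // /(congr1 (findex (contour u) s)); rewrite findex0 -iterS findex_iter //.
by apply: leq_ltn_trans ltd; apply: leqW (ltn_ord i).
Qed.

Lemma corner_label_root : corner_label (root o) = 0.
Proof. by rewrite /corner_label /contour_time findex0 big_ord0. Qed.

Lemma rooted_labelled : unicellular o -> well_labeled o -> well_oriented o -> @labelled u s.
Proof.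
move=> /(unicellularE (m := u) s) conn [wl1 wl2] wo.
have f_inj : injective t.
  move=> d e eq_f; by rewrite -(iter_findex (conn d)) eq_f iter_findex.
have labc d := corner_labelE (conn d).
have oppE (d : o) : ~~ is_stem d -> corner_label (opp o d) = corner_label (rot o d).
  by move=> ds; rewrite -{2}(oppK d) wl1 ?nonstem_opp.
split=> //.
- exact: lab0.
- by move=> d /(findex_contour_connect conn) ->.
- move=> d; have [c0|neq] := eqVneq (contour u d) s; last first.
    by rewrite (lab_contour_connect conn) ?addr0.
  rewrite c0 lab0; have c0' : rot o (opp o d) = root o by have := c0; rewrite contourE.
  (* Well-labeledness at the last step brings the rooted label back to 0; with the root turned into
     a leaf this becomes the jump of 2. *)
  suff : corner_label (d : o) + label_increment (d : o) = 0.
    by rewrite labc label_incrementE; case: eqP; lia.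
  have [st|nst] := boolP (is_stem (d : o)).
    have := wl2 d; rewrite -{1}(eqP st) c0' corner_label_root /label_increment /points_away st /=.
    by move=> ->.
  by rewrite /label_increment nst addr0 -(wl1 d nst) c0' corner_label_root.
move=> d; rewrite -[is_stem (d : u)]/(is_stem (d : o)) => ds lt_t.
have ds0 : d != s by apply: contraNneq ds => ->; apply: bud_stem (root_is_bud o).
have os0 : opp o d != s.
  by apply: contraNneq ds => eqs; rewrite -nonstem_opp eqs; apply: bud_stem (root_is_bud o).
have := wl2 d; rewrite -oppE // !labc (negbTE ds0) (negbTE os0) /points_away (negbTE ds) (wo _ ds).
by rewrite /contour_time ltnNge (ltnW lt_t) /=; lia.
Qed.

Lemma labelled_well_labeled : @labelled u s -> well_oriented o -> well_labeled o.
Proof.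
move=> lab_u wo; have conn := labelled_connect lab_u.
have labc d := corner_labelE (conn d).
have labS (d : o) : corner_label (rot o (opp o d)) = corner_label d + label_increment d.
  have := labS lab_u d; rewrite contourE !labc label_incrementE.
  by rewrite -/(rot o _) -/(opp o d); do 2 case: ifP; lia.
split=> [d ds|d]; first by rewrite labS /label_increment ds addr0.
rewrite -{1}(oppK d) labS /points_away /label_increment nonstem_opp.
have [st|ds] := boolP (is_stem d) => /=.
  by rewrite (eqP st).
have ds0 : d != s by apply: contraNneq ds => ->; apply: bud_stem (root_is_bud o).
have os0 : opp o d != s.
  by apply: contraNneq ds => eqs; rewrite -nonstem_opp eqs; apply: bud_stem (root_is_bud o).
rewrite !labc (negbTE ds0) (negbTE os0) (wo _ ds) /contour_time.
have := lab_opp lab_u ds; have [f_inj _ _ _ _] := lab_u.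
rewrite -/(opp o d) => ->; case: ltngtP; try lia.
by move/f_inj/esym/eqP=> st; case/negP: ds.
Qed.

(** The former root is a leaf labelled 0, hence black: it accounts for the extra 1 in the exponent
    of the first variable. The label of any leaf is that of the corner it follows, the larger of its
    two neighbours. *)
Lemma black_white_leaves : @labelled u s -> well_labeled o ->
  (black_leaves o).+1 = @colored_leaves u s false /\ white_leaves o = @colored_leaves u s true.
Proof.
move=> lab_u [_ wl2]; have conn := labelled_connect lab_u.
have parity (d : o) : is_leaf d -> (2%:Z %| stem_label d)%Z = ~~ odd `|@lab u s d|%N.
  case/andP=> st db; rewrite /stem_label wl2 /points_away st (negbTE db).
  rewrite maxEle ifN; last by rewrite -ltNge; lia.
  by rewrite (corner_labelE (conn d)) dvdzE dvdn2; case: ifP; lia.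
split.
  rewrite /black_leaves /colored_leaves (cardsD1 (s : u)) inE unroot_root_leaf lab0 add1n.
  congr _.+1; apply: eq_card => d; rewrite !inE unroot_leaf.
  have [->|_] := eqVneq d s; first by rewrite /is_leaf root_is_bud andbF.
  by rewrite orbF; have [/parity ->|//] := boolP (is_leaf _); rewrite eqbF_neg.
rewrite /white_leaves /colored_leaves; apply: eq_card => d; rewrite !inE unroot_leaf.
have [->|_] := eqVneq d s; first by rewrite lab0 /is_leaf root_is_bud andbF.
by rewrite orbF; have [/parity ->|//] := boolP (is_leaf _); rewrite negbK eqb_id.
Qed.

Lemma good_mapE : good_map o <->
  [/\ four_valent u, @labelled u s, well_oriented o & @good_leaf u s].
Proof.
split=> [[uni m4 [_ nonneg] wl wo]|[m4 lab_u wo [_ ge2]]].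
  have lab_u := rooted_labelled uni wl wo; split=> //; split; first exact: unroot_root_leaf.
  move=> d; have := nonneg d; rewrite corner_labelE; last exact: labelled_connect lab_u d.
  by case: eqP; lia.
split=> //; first exact: labelled_unicellular lab_u.
- split; last first.
    move=> d; rewrite corner_labelE; last exact: labelled_connect lab_u d.
    by have := ge2 d; case: eqP => [->|]; rewrite ?lab0; lia.
  have := card_leaf_bud lab_u; rewrite (cardsD1 (s : u)) inE unroot_root_leaf.
  rewrite (cardsD1 (root o) (bud o)) root_is_bud.
  have -> : [set d : u | is_leaf d] :\ s = [set d : o | is_leaf d].
    apply/setP=> d; rewrite !inE unroot_leaf; have [->|_] := eqVneq d s; last by rewrite orbF.
    by rewrite /is_leaf root_is_bud andbF.
  have -> : #|bud u| = #|bud o :\ root o| by [].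
  by rewrite !add1n addn2 => -[->].
exact: labelled_well_labeled.
Qed.

Lemma in_RE : in_R o <->
  [/\ four_valent u, @labelled u s, well_oriented o,
      forall v, v \in vertices u -> (2 <= interior_degree v)%N
    & (3 <= interior_degree (vertex_of s))%N].
Proof.
split=> [[/andP[uni /forallP core] m4 wo wl deg3]|[m4 lab_u wo core deg3]].
  split=> //; first exact: rooted_labelled.
  by move=> v vv; have := core v; rewrite vv.
split=> //; last exact: labelled_well_labeled.
apply/andP; split; first exact: labelled_unicellular lab_u.
apply/forallP=> v; apply/implyP; exact: core.
Qed.

End Rooted.

Section Reroot.

Variables (u : blossoming_map) (s : u).
Hypothesis leaf_s : is_leaf s.
Hypothesis lab_u : labelled s.

Lemma reroot_bud_is_stem d : d \in s |: bud u -> opp u d = d.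
Proof.
by rewrite !inE => /orP[/eqP->|/bud_is_stem//]; case/andP: leaf_s => /eqP.
Qed.

Definition reroot_map : blossoming_map :=
  BlossomingMap (@oppK u) reroot_bud_is_stem (@map_connected u).

(** Well-orientedness leaves no choice: the origin of an edge is its half that the contour meets
    last. *)
Definition reroot_tail : {set reroot_map} :=
  [set d : u | ~~ is_stem d && (findex (contour u) s (opp u d) < findex (contour u) s d)%N].

Lemma reroot_tail_orientation (d : reroot_map) :
  if is_stem d then d \notin reroot_tail
  else (opp reroot_map d \in reroot_tail) == (d \notin reroot_tail).
Proof.
rewrite !inE -[is_stem d]/(is_stem (d : u)) -[opp reroot_map d]/(opp u d) nonstem_opp oppK.
have [//|ds] := boolP (is_stem (d : u)); rewrite /= -leqNgt.
have [f_inj _ _ _ _] := lab_u; case: ltngtP => // /f_inj eqd.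
by case/negP: ds; apply/eqP.
Qed.

Lemma reroot_is_bud : s \in bud reroot_map.
Proof. by rewrite !inE eqxx. Qed.

Definition reroot : rooted_map := RootedMap reroot_is_bud reroot_tail_orientation.

Lemma reroot_well_oriented : well_oriented reroot.
Proof. by move=> d ds; rewrite inE -[is_stem (d : u)]/(is_stem (d : reroot)) ds. Qed.

Lemma unroot_reroot : @is_iso u (unroot reroot) id.
Proof.
split=> // [|d]; first by exists id.
by rewrite !inE; have [->|] := eqVneq d s; [case/andP: leaf_s => _ /negbTE ->|].
Qed.

End Reroot.

Definition is_rooted_iso (o o' : rooted_map) (f : o -> o') : Prop :=
  [/\ bijective f,
      (forall d, f (rot o d) = rot o' (f d)) /\ (forall d, f (opp o d) = opp o' (f d)),
      forall d, (f d \in bud o') = (d \in bud o),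
      forall d, (f d \in tail o') = (d \in tail o)
    & f (root o) = root o'].

(** An isomorphism matching the roots preserves contour times, and these determine the
    orientations. *)
Lemma unroot_rooted_iso (o o' : rooted_map) (f : o -> o') :
    well_oriented o -> well_oriented o' -> @is_iso (unroot o) (unroot o') f ->
  f (root o) = root o' -> is_rooted_iso f.
Proof.
move=> wo wo' iso_f f_root; have [fb fr fo fbud] := iso_f; have f_inj := iso_inj iso_f.
have fst (d : o) : is_stem (f d) = is_stem d := iso_stem iso_f d.
split=> // d.
  have := fbud d; rewrite !inE; have [->|ds] := eqVneq d (root o).
    by rewrite f_root !root_is_bud.
  by rewrite -f_root (inj_eq f_inj) ds.
have := tail_orientation d; have := tail_orientation (f d); rewrite fst.
have [sd /negbTE -> /negbTE -> //|ds _ _] := boolP (is_stem d).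
rewrite wo // wo' ?fst // /contour_time -fo -f_root.
have fi e : findex (contour o') (f (root o)) (f e) = findex (contour o) (root o) e.
  rewrite /findex /fingraph.orbit.
  have fc (x : o) : f (contour o x) = contour o' (f x) := iso_contour iso_f x.
  have ord : fingraph.order (contour o') (f (root o)) = fingraph.order (contour o) (root o).
    rewrite /fingraph.order -(card_image f_inj); apply: eq_card => y.
    apply/idP/imageP=> [/iter_findex <-|[x xr ->]].
      exists (iter (findex (contour o') (f (root o)) y) (contour o) (root o)).
        exact: fconnect_iter.
      by elim: (findex _ _ _) => //= n ->; rewrite fc.
    rewrite -(iter_findex xr); elim: (findex _ _ _) => [|n IHn]; first exact: connect0.
    by rewrite /= fc; apply: connect_trans IHn (fconnect1 _ _).
  rewrite ord; have -> : traject (contour o') (f (root o)) (fingraph.order (contour o) (root o))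
      = map f (traject (contour o) (root o) (fingraph.order (contour o) (root o))).
    move: (fingraph.order (contour o) (root o)) => n.
    by elim: n (root o) => //= n IHn x; rewrite -fc IHn.
  by rewrite index_map.
by rewrite !fi.
Qed.

Lemma rooted_iso_is_iso (o o' : rooted_map) (f : o -> o') :
  is_rooted_iso f -> @is_iso (unroot o) (unroot o') f.
Proof.
move=> [fb [fr fo] fbud _ f_root]; split=> // d.
by rewrite !inE fbud -f_root (inj_eq (bij_inj fb)).
Qed.

(** * Bivariate power series and counting up to isomorphism *)

(** Each coefficient of a product involves only a truncation of its factors, so commutativity and
    associativity are inherited from polynomials. *)
Definition series_poly (n : nat) (F : series2) : {poly {poly rat}} :=
  \poly_(i < n) \poly_(j < n) F i j.

Lemma series_polyE n F i j : (i < n)%N -> (j < n)%N -> (series_poly n F)`_i`_j = F i j.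
Proof. by move=> lti ltj; rewrite !coef_poly lti coef_poly ltj. Qed.

Lemma coef2M (p q : {poly {poly rat}}) i j :
  (p * q)`_i`_j = \sum_(k < i.+1) \sum_(l < j.+1) p`_k`_l * q`_(i - k)`_(j - l).
Proof. by rewrite coefM coef_sum; apply: eq_bigr => k _; rewrite coefM. Qed.

Lemma series_mulE n F G (p q : {poly {poly rat}}) i j : (i < n)%N -> (j < n)%N ->
    (forall k l, (k < n)%N -> (l < n)%N -> p`_k`_l = F k l) ->
    (forall k l, (k < n)%N -> (l < n)%N -> q`_k`_l = G k l) ->
  (p * q)`_i`_j = series_mul F G i j.
Proof.
move=> lti ltj pF qG; rewrite coef2M; apply: eq_bigr => k _; apply: eq_bigr => l _.
have ltk := ltn_ord k; have ltl := ltn_ord l.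
by rewrite pF ?qG //; lia.
Qed.

Lemma series_mulC : commutative series_mul.
Proof.
move=> F G; apply: funext => i; apply: funext => j; set n := (i + j).+1.
have [lti ltj] : (i < n)%N /\ (j < n)%N by lia.
rewrite -(series_mulE lti ltj (@series_polyE n F) (@series_polyE n G)) mulrC.
exact: series_mulE lti ltj (@series_polyE n G) (@series_polyE n F).
Qed.

Lemma series_mulA : associative series_mul.
Proof.
move=> F G H; apply: funext => i; apply: funext => j; set n := (i + j).+1.
have [lti ltj] : (i < n)%N /\ (j < n)%N by lia.
have pF := @series_polyE n F; have pG := @series_polyE n G; have pH := @series_polyE n H.
have pFG k l (ltk : (k < n)%N) (ltl : (l < n)%N) := series_mulE ltk ltl pF pG.
have pGH k l (ltk : (k < n)%N) (ltl : (l < n)%N) := series_mulE ltk ltl pG pH.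
by rewrite -(series_mulE lti ltj pF pGH) -(series_mulE lti ltj pFG pH) mulrA.
Qed.

Definition monomial (a b : nat) : series2 := fun i j => ((i == a) && (j == b))%:R.

Lemma monomial_mul a b (F : series2) i j :
  series_mul (monomial a b) F i j =
    if (a <= i)%N && (b <= j)%N then F (i - a)%N (j - b)%N else 0.
Proof.
rewrite /series_mul /monomial.
have [le_ai|lt_ia] /= := leqP a i; last first.
  rewrite big1 // => k _; rewrite big1 // => l _.
  by have /negbTE -> : (k : nat) != a; rewrite ?mul0r //; have := ltn_ord k; lia.
have [le_bj|lt_jb] /= := leqP b j; last first.
  rewrite big1 // => k _; rewrite big1 // => l _.
  by rewrite [_ && _]andbC; have /negbTE -> : (l : nat) != b; rewrite ?mul0r //; have := ltn_ord l; lia.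
rewrite (bigD1 (Ordinal (leq_ltn_trans le_ai (ltnSn i)))) //= [X in _ + X]big1 ?addr0; last first.
  move=> k /negbTE ka; rewrite big1 // => l _.
  by rewrite -[(k : nat) == a]/(k == Ordinal (leq_ltn_trans le_ai (ltnSn i))) ka mul0r.
rewrite (bigD1 (Ordinal (leq_ltn_trans le_bj (ltnSn j)))) //= !eqxx mul1r [X in _ + X]big1 ?addr0 //.
move=> l /negbTE lb.
by rewrite -[(l : nat) == b]/(l == Ordinal (leq_ltn_trans le_bj (ltnSn j))) lb mul0r.
Qed.

Lemma series_mul1 : left_id series_one series_mul.
Proof.
move=> F; apply: funext => i; apply: funext => j.
by rewrite -[series_one]/(monomial 0 0) monomial_mul !subn0.
Qed.

HB.instance Definition _ :=
  Monoid.isComLaw.Build series2 series_one series_mul series_mulA series_mulC series_mul1.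

Lemma monomialM a b c d : series_mul (monomial a b) (monomial c d) = monomial (a + c) (b + d).
Proof.
apply: funext => i; apply: funext => j; rewrite monomial_mul /monomial.
case: ifP => [le_ab|nle_ab]; first by congr (nat_of_bool _)%:R; apply/idP/idP; lia.
by have /negbTE -> : ~~ ((i == a + c)%N && (j == b + d)%N) by lia.
Qed.

Lemma series_mulDl F G H i j :
  series_mul (fun i j => F i j + G i j) H i j = series_mul F H i j + series_mul G H i j.
Proof.
rewrite -big_split /=; apply: eq_bigr => k _; rewrite -big_split /=.
by apply: eq_bigr => l _; rewrite mulrDl.
Qed.

Definition series_ord_ge (n : nat) (F : series2) : Prop :=
  forall i j, (i + j < n)%N -> F i j = 0.

Lemma series_ord_geM n p F G : series_ord_ge n F -> series_ord_ge p G ->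
  series_ord_ge (n + p) (series_mul F G).
Proof.
move=> oF oG i j lt_ij; rewrite /series_mul big1 // => k _; rewrite big1 // => l _.
have ltk := ltn_ord k; have ltl := ltn_ord l.
have [lt|le] := ltnP (k + l) n; first by rewrite oF ?mul0r.
by rewrite oG ?mulr0 //; lia.
Qed.

Lemma series_ord_ge_prod (I : finType) (P : pred I) (F : I -> series2) :
  (forall a, P a -> F a 0%N 0%N = 0) ->
  series_ord_ge #|P| (\big[series_mul/series_one]_(a | P a) F a).
Proof.
move=> F0; rewrite -sum1_card.
elim/big_rec2: _ => [i j //|a n G Pa oG]; apply: series_ord_geM oG => i j.
by case: i j => [|i] [|j] // _; apply: F0.
Qed.

Lemma monomial_prod (I : finType) (P Q : pred I) :
  \big[series_mul/series_one]_(a | P a) (if Q a then series_Y else series_X)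
  = monomial #|[pred a | P a && ~~ Q a]| #|[pred a | P a && Q a]|.
Proof.
rewrite -!sum1_card !big_mkcondr /=.
elim/big_rec3: _ => [//|a F n p Pa ->]; case: (Q a) => /=.
  exact: (monomialM 0 1).
exact: (monomialM 1 0).
Qed.

(** * Counting up to an arbitrary relation *)

Section Counting.

Variables (T : Type) (R : T -> T -> Prop).

(** With [rooted_iso] for [R] this is [has_count] up to conversion; the other relations concern maps
    that carry an embedding. *)
Definition counted (P : T -> Prop) (k : nat) : Prop :=
  exists s : 'I_k -> T,
    [/\ forall i, P (s i), forall i j, R (s i) (s j) -> i = j
      & forall x, P x -> exists i, R (s i) x].

Lemma counted_fin (I : finType) (P : T -> Prop) (s : I -> T) :
    (forall i, P (s i)) -> (forall i j, R (s i) (s j) -> i = j) ->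
    (forall x, P x -> exists i, R (s i) x) ->
  counted P #|I|.
Proof.
move=> Ps sR sP; exists (fun i => s (enum_val i)); split=> // [i j /sR/enum_val_inj //|x /sP[i Ri]].
by exists (enum_rank i); rewrite enum_rankK.
Qed.

Lemma counted_ext (P Q : T -> Prop) k : (forall x, P x <-> Q x) -> counted P k -> counted Q k.
Proof.
move=> PQ [s [sP sR sall]]; exists s; split=> // [i|x /PQ]; [exact/PQ|exact: sall].
Qed.

Lemma counted0 (P : T -> Prop) : (forall x, ~ P x) -> counted P 0.
Proof. by move=> nP; exists (fun i : 'I_0 => let: Ordinal _ lt := i in match notF lt with end); split=> [[]|[]|x /nP]. Qed.

Lemma countedU (P Q : T -> Prop) k l :
    (forall x y, P x -> Q y -> ~ R x y) -> (forall x y, P x -> Q y -> ~ R y x) ->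
  counted P k -> counted Q l -> counted (fun x => P x \/ Q x) (k + l).
Proof.
move=> PQ QP [s [sP sR sall]] [s' [sQ sR' sall']].
rewrite -[k]card_ord -[l]card_ord -card_sum.
apply: (@counted_fin _ _ (fun i => match i with inl i => s i | inr i => s' i end)).
- by case=> i; [left|right].
- case=> i [] j.
  + by move=> /sR ->.
  + by move=> /PQ; case.
  + by move=> /QP; case.
  by move=> /sR' ->.
by move=> x [/sall[i Ri]|/sall'[i Ri]]; [exists (inl i)|exists (inr i)].
Qed.

End Counting.

Section CountingTransfer.

Variables (T1 T2 : Type) (R1 : T1 -> T1 -> Prop) (R2 : T2 -> T2 -> Prop) (F : T1 -> T2).
Variables (P1 : T1 -> Prop) (P2 : T2 -> Prop).
Hypothesis R2_sym : forall x y, R2 x y -> R2 y x.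
Hypothesis R2_trans : forall x y z, R2 x y -> R2 y z -> R2 x z.
Hypothesis F_P : forall x, P1 x -> P2 (F x).
Hypothesis F_R : forall x y, P1 x -> P1 y -> (R2 (F x) (F y) <-> R1 x y).
Hypothesis F_surj : forall y, P2 y -> exists2 x, P1 x & R2 (F x) y.

Lemma counted_image k : counted R1 P1 k -> counted R2 P2 k.
Proof.
move=> [s [sP sR sall]]; exists (F \o s); split=> [i|i j|y] /=.
- exact: F_P.
- by move/F_R => /(_ (sP i) (sP j)); apply: sR.
move=> /F_surj[x Px FxR]; have [i Ri] := sall x Px.
by exists i; apply: R2_trans FxR; apply/F_R.
Qed.

Lemma counted_preimage k : counted R2 P2 k -> counted R1 P1 k.
Proof.
move=> [s [sP sR sall]].
have pre i : {x | P1 x /\ R2 (F x) (s i)}.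
  by apply: cid; have [x] := F_surj (sP i); exists x.
exists (fun i => sval (pre i)); split=> [i|i j|x Px].
- by case: (pre i) => x [].
- case: (pre i) (pre j) => x [Px xi] [y [Py yj]] /= /F_R => /(_ Px Py) xy.
  by apply: sR; apply: R2_trans (R2_sym xi) (R2_trans xy yj).
have [i Ri] := sall _ (F_P Px); exists i; case: (pre i) => y [Py yi] /=.
by apply/F_R => //; apply: R2_trans yi Ri.
Qed.

End CountingTransfer.

(** * Counting the maps grown from a core *)

(** Isomorphisms over [m] fix the copy of [m], so what grows at one leaf is independent of the
    others and products of series count correctly. *)
Record map_over (m : blossoming_map) := MapOver { over_map :> blossoming_map; over_emb : m -> over_map }.

Definition over_iso (m : blossoming_map) (X Y : map_over m) : Prop :=
  exists2 f : X -> Y, is_iso f & forall d, f (over_emb X d) = over_emb Y d.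

Lemma over_iso_sym m (X Y : map_over m) : over_iso X Y -> over_iso Y X.
Proof.
move=> [f iso_f fE]; have [[g fK gK] _ _ _] := iso_f.
by exists g => [|d]; [exact: (iso_inv iso_f fK gK)|rewrite -fE fK].
Qed.

Lemma over_iso_trans m (X Y Z : map_over m) : over_iso X Y -> over_iso Y Z -> over_iso X Z.
Proof.
move=> [f iso_f fE] [g iso_g gE]; exists (g \o f); first exact: is_iso_comp.
by move=> d; rewrite /= fE gE.
Qed.

Lemma odd_abszD (x y : int) : odd (absz (x + y)) = odd (absz x) (+) odd (absz y).
Proof. by apply/eqP; lia. Qed.

Section Substitution.

Variables (Tb Tw : series2).
Hypothesis T_sys : T_system Tb Tw.

Definition tree_series (c : bool) : series2 := if c then Tw else Tb.
Definition leaf_series (c : bool) : series2 := if c then series_Y else series_X.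

Lemma tree_series0 c : tree_series c 0%N 0%N = 0.
Proof. by case: T_sys; case: c. Qed.

(** The three products are the three positions of the bud: by [expand_shift], the colours of the two
    leaves relative to [c] are opposite and equal, both equal, or equal and opposite. *)
Lemma tree_seriesE c i j : tree_series c i j = leaf_series c i j
  + (series_mul (tree_series (~~ c)) (tree_series c) i j
     + series_mul (tree_series c) (tree_series c) i j
     + series_mul (tree_series c) (tree_series (~~ c)) i j).
Proof.
case: T_sys => _ _ eqb eqw; rewrite [series_mul (tree_series c) (tree_series (~~ c))]series_mulC.
case: c => /=; [rewrite eqw [series_mul Tb Tw]series_mulC|rewrite eqb]; ring.
Qed.

Definition color (m : blossoming_map) (x0 : m) (eps : bool) (d : m) : bool :=
  odd `|lab x0 d|%N (+) eps.

(* Leaves in [A] may be expanded into trees, the others may not. *)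
Definition growth_series (m : blossoming_map) (x0 : m) (eps : bool) (A : {set m}) : series2 :=
  \big[series_mul/series_one]_(a | is_leaf a)
     (if a \in A then tree_series (color x0 eps a) else leaf_series (color x0 eps a)).

(** A leaf is black for [color] when its label has parity [eps], so [i] counts black leaves and [j]
    white ones. *)
Definition grown (m : blossoming_map) (x0 : m) (eps : bool) (A : {set m}) (i j : nat)
    (X : map_over m) : Prop :=
  [/\ embedding (over_emb X), forall a, is_leaf a -> a \notin A -> is_stem (over_emb X a),
      colored_leaves (over_emb X x0) eps = i & colored_leaves (over_emb X x0) (~~ eps) = j].

Lemma card_leaves_color (m : blossoming_map) (x0 : m) eps :
  #|[set d : m | is_leaf d]| = (colored_leaves x0 eps + colored_leaves x0 (~~ eps))%N.
Proof.
rewrite /colored_leaves -(cardsID [set d | odd `|lab x0 d|%N == eps]); congr (_ + _)%N.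
  by apply: eq_card => d; rewrite !inE.
by apply: eq_card => d; rewrite !inE andbC; case: (odd _); case: eps.
Qed.

(** Both maps have two leaves more than buds, and the embedding sends buds to buds injectively. *)
Lemma grown_leaves (m : blossoming_map) (x0 : m) eps A i j X :
  labelled x0 -> four_valent m -> grown x0 eps A i j X ->
  (#|[set d : m | is_leaf d]| <= i + j)%N.
Proof.
move=> lab_m m4 [emb_e _ <- <-]; have [lab_u _ _] := embedding_grow emb_e lab_m m4.
rewrite -card_leaves_color (card_leaf_bud lab_m) (card_leaf_bud lab_u) leq_add2r.
rewrite -(card_imset _ (emb_inj emb_e)); apply/subset_leq_card/subsetP=> _ /imsetP[d db ->].
by rewrite (emb_bud emb_e).
Qed.

Lemma growth_series_ord (m : blossoming_map) (x0 : m) eps A :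
  series_ord_ge #|[set d : m | is_leaf d]| (growth_series x0 eps A).
Proof.
rewrite cardsE; apply: series_ord_ge_prod => a _.
by case: ifP => _; rewrite ?tree_series0 //; case: color.
Qed.

Lemma growth_series0 (m : blossoming_map) (x0 : m) eps i j :
  growth_series x0 eps set0 i j =
    ((i == colored_leaves x0 eps) && (j == colored_leaves x0 (~~ eps)))%:R.
Proof.
rewrite /growth_series; under eq_bigr do rewrite inE.
rewrite monomial_prod /monomial /colored_leaves.
congr (nat_of_bool ((i == _) && (j == _)))%:R; apply: eq_card => d; rewrite !inE /color;
  by case: (odd _); case: eps.
Qed.

Lemma count_grown0 (m : blossoming_map) (x0 : m) eps i j : labelled x0 ->
  exists2 k : nat, k%:R = growth_series x0 eps set0 i j
    & counted (@over_iso m) (grown x0 eps set0 i j) k.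
Proof.
move=> lab_m; rewrite growth_series0.
have iso_of X : grown x0 eps set0 i j X -> is_iso (over_emb X).
  move=> [emb_e st _ _]; apply: (emb_surj emb_e x0) => a leaf_a.
  by apply: st; rewrite ?inE.
have [/andP[/eqP-> /eqP->]|ne] := boolP (_ && _).
  exists 1%N => //; exists (fun=> @MapOver m m id); split.
  - by move=> _; split=> //; [apply: iso_embedding; split=> //; exists id | move=> d /andP[]].
  - by move=> i1 j1 _; rewrite !ord1.
  move=> X gX; exists ord0; exists (over_emb X) => //.
  case: gX => emb_e st _ _; apply: (emb_surj emb_e x0) => a leaf_a.
  by apply: st; rewrite ?inE.
exists 0%N => //; apply: counted0 => X gX; have iso_e := iso_of X gX.
case: gX => _ _; rewrite !(iso_colored_leaves _ iso_e) // => ci cj.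
by move: ne; rewrite ci cj !eqxx.
Qed.

Section Step.

Variables (m : blossoming_map) (x0 a : m) (eps : bool) (A : {set m}).
Hypothesis lab_m : labelled x0.
Hypothesis m4 : four_valent m.
Hypothesis leaf_a : is_leaf a.
Hypothesis aA : a \in A.

Definition expand_active (b : 'I_3) : {set expand b leaf_a} :=
  [set x : m + 'I_4 | match x with
                      | inl d => (d \in A) && (d != a)
                      | inr i => (i != 0) && (i != lift ord0 b)
                      end].

(** One use of the tree equation at [a]: it stays a leaf, or becomes a vertex with one of three bud
    positions whose two leaves may grow in turn. *)
Lemma growth_seriesS i j :
  growth_series x0 eps A i j = growth_series x0 eps (A :\ a) i j +
    (growth_series (inl x0 : expand 0 leaf_a) eps (expand_active 0) i j
     + growth_series (inl x0 : expand 1 leaf_a) eps (expand_active 1) i j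
     + growth_series (inl x0 : expand 2%:R leaf_a) eps (expand_active 2%:R) i j).
Proof.
pose rest := \big[series_mul/series_one]_(d | is_leaf d && (d != a))
  (if d \in A then tree_series (color x0 eps d) else leaf_series (color x0 eps d)).
have -> : growth_series x0 eps A = series_mul (tree_series (color x0 eps a)) rest.
  by rewrite /growth_series (bigD1 a) //= aA.
have -> : growth_series x0 eps (A :\ a) = series_mul (leaf_series (color x0 eps a)) rest.
  rewrite /growth_series (bigD1 a) //= !inE eqxx /=; congr series_mul.
  by apply: eq_bigr => d /andP[_ da]; rewrite !inE da.
have expandE b : growth_series (inl x0 : expand b leaf_a) eps (expand_active b) =
    series_mul (\big[series_mul/series_one]_(i : 'I_4 | (i != 0) && (i != lift ord0 b))
       tree_series (color x0 eps a (+) odd `|expand_shift b i|%N)) rest.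
  have [_ labE] := expand_labelled_lab b leaf_a lab_m.
  rewrite /growth_series big_sumType /= series_mulC; congr series_mul.
    apply: eq_big => [k|k]; first by rewrite expand_leafr.
    rewrite expand_leafr inE => ->; congr tree_series.
    by rewrite /color labE odd_abszD addbAC.
  apply: eq_big => [d|d]; first by rewrite expand_leafl andbC.
  by rewrite expand_leafl inE => /andP[-> _]; rewrite andbT /color labE.
set c := color x0 eps a.
have -> : tree_series c = fun i j => leaf_series c i j
    + (fun i j => (fun i j => series_mul (tree_series (~~ c)) (tree_series c) i j
                   + series_mul (tree_series c) (tree_series c) i j) i j
       + series_mul (tree_series c) (tree_series (~~ c)) i j) i j.
  by apply: funext => i'; apply: funext => j'; apply: tree_seriesE.
rewrite !series_mulDl !expandE; congr (_ + (_ + _ + _));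
  congr (series_mul _ rest i j); rewrite big_mkcond !big_ord_recl big_ord0 /=;
  by rewrite -/c ?addbT ?addbF !series_mul1 ?[series_mul _ series_one]Monoid.mulm1
             ?series_mul1 ?[series_mul _ series_one]Monoid.mulm1.
Qed.

Definition expand_over (b : 'I_3) (X : map_over (expand b leaf_a)) : map_over m :=
  MapOver (fun d => over_emb X (inl d)).

(** An isomorphism fixing [m] also fixes the new vertex: half-edge 0 faces [a], and rotation reaches
    the other three. *)
Lemma expand_over_iso b (X Y : map_over (expand b leaf_a)) :
  embedding (over_emb X) -> embedding (over_emb Y) ->
  over_iso (expand_over X) (expand_over Y) <-> over_iso X Y.
Proof.
move=> emb_X emb_Y; split=> [[f iso_f fE]|[f iso_f fE]]; last first.
  by exists f => // d; apply: fE.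
exists f => // -[d|k]; first exact: fE.
have [_ fr fo _] := iso_f.
have f0 : f (over_emb X (inr 0)) = over_emb Y (inr 0).
  have a_nst : ~~ is_stem (inl a : expand b leaf_a) by rewrite expand_steml eqxx.
  have oa : opp (expand b leaf_a) (inl a) = inr 0 by rewrite expand_oppl eqxx.
  by rewrite -oa -(emb_nonstem emb_X a_nst) -(emb_nonstem emb_Y a_nst) fo fE.
have stepS i : f (over_emb X (inr i)) = over_emb Y (inr i) ->
    f (over_emb X (inr (i + 1))) = over_emb Y (inr (i + 1)).
  by move=> fi; rewrite -expand_rotr (emb_rot emb_X) (emb_rot emb_Y) fr fi.
have f1 := stepS 0 f0; have f2 := stepS _ f1; have f3 := stepS _ f2.
elim/ord4_ind: k => //; [move: f1|move: f2|move: f3];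
  by congr (f (over_emb X (inr _)) = over_emb Y (inr _)); apply: val_inj.
Qed.

Lemma expand_over_grown b i j (X : map_over (expand b leaf_a)) :
    grown (inl x0 : expand b leaf_a) eps (expand_active b) i j X ->
  grown x0 eps A i j (expand_over X) /\ ~~ is_stem (over_emb (expand_over X) a).
Proof.
move=> [emb_X st ci cj]; split.
  split=> //; first exact: embedding_restrict emb_X.
  move=> d ld dA /=; apply: st; rewrite ?expand_leafl ?inE ?(negbTE dA) //.
  by rewrite ld andbT; apply: contraNneq dA => ->.
rewrite /= (emb_is_stem emb_X); first by rewrite expand_steml eqxx.
by rewrite expand_leafl eqxx.
Qed.

Lemma count_expand b i j k :
    counted (@over_iso (expand b leaf_a))
      (grown (inl x0 : expand b leaf_a) eps (expand_active b) i j) k ->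
  counted (@over_iso m) (fun Y => exists2 X : map_over (expand b leaf_a),
    grown (inl x0 : expand b leaf_a) eps (expand_active b) i j X & Y = expand_over X) k.
Proof.
apply: (counted_image (F := @expand_over b)).
- exact: over_iso_trans.
- by move=> X gX; exists X.
- by move=> X Y [emb_X _ _ _] [emb_Y _ _ _]; apply: expand_over_iso.
move=> Y [X gX ->]; exists X => //; exists id => //.
by split=> //; exists id.
Qed.

(** By the same propagation from [a], an isomorphism would match the buds of the two new
    vertices. *)
Lemma expand_over_neq b b' (X : map_over (expand b leaf_a)) (Y : map_over (expand b' leaf_a)) :
    embedding (over_emb X) -> embedding (over_emb Y) -> b != b' ->
  ~ over_iso (expand_over X) (expand_over Y).
Proof.
move=> emb_X emb_Y neq [f iso_f fE]; have [_ fr fo fb] := iso_f.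
have f0 : f (over_emb X (inr 0)) = over_emb Y (inr 0).
  have oa b0 : opp (expand b0 leaf_a) (inl a) = inr 0 by rewrite expand_oppl eqxx.
  have a_nst b0 : ~~ is_stem (inl a : expand b0 leaf_a) by rewrite expand_steml eqxx.
  have fa := fE a; rewrite /= in fa.
  by rewrite -!oa -(emb_nonstem emb_X (a_nst b)) -(emb_nonstem emb_Y (a_nst b')) fo fa.
have fn n : f (over_emb X (inr n%:R)) = over_emb Y (inr n%:R).
  elim: n => [//|n IHn].
  by rewrite -natr1 -!expand_rotr (emb_rot emb_X) (emb_rot emb_Y) fr IHn.
have := fb (over_emb X (inr (lift ord0 b))); rewrite -(natr_Zp (lift ord0 b)) fn.
rewrite (emb_bud emb_X) (emb_bud emb_Y) !expand_budr natr_Zp eqxx (inj_eq lift_inj).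
by rewrite (negbTE neq).
Qed.

Lemma grown_split i j X : grown x0 eps A i j X <->
  grown x0 eps (A :\ a) i j X \/
  exists b (Y : map_over (expand b leaf_a)),
    grown (inl x0 : expand b leaf_a) eps (expand_active b) i j Y /\ X = expand_over Y.
Proof.
split=> [[emb_X st ci cj]|[[emb_X st ci cj]|[b [Y [gY ->]]]]]; last first.
- by case: (expand_over_grown gY).
- by split=> // d ld dA; apply: st => //; rewrite inE (negbTE dA) andbF.
have [sta|nsta] := boolP (is_stem (over_emb X a)).
  left; split=> // d ld; rewrite !inE negb_and negbK => /orP[/eqP -> //|dA].
  exact: st.
right; have [b [e' [emb_e' e'E]]] := embedding_extend leaf_a emb_X nsta.
exists b, (MapOver e'); split; last first.
  case: X e' {emb_X st ci cj nsta emb_e'} e'E => u e e' e'E; rewrite /expand_over /=.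
  by congr MapOver; apply: funext => d; rewrite e'E.
split=> //=; rewrite ?e'E //; move=> [d|k].
  rewrite expand_leafl inE e'E => /andP[da ld]; rewrite da andbT => dA; exact: st.
by rewrite expand_leafr inE => ->.
Qed.

End Step.

Lemma card_expand_set (m : blossoming_map) (a : m) (leaf_a : is_leaf a) b (P : pred (m + 'I_4)) :
  #|[set x : expand b leaf_a | P x]| = (#|[pred d | P (inl d)]| + #|[pred k | P (inr k)]|)%N.
Proof. by rewrite cardsE -!sum1_card big_sumType. Qed.

Lemma card_inr_leaves (b : 'I_3) : #|[pred k : 'I_4 | (k != 0) && (k != lift ord0 b)]| = 2%N.
Proof.
rewrite -sum1_card big_mkcond !big_ord_recl big_ord0.
by case: b => [[|[|[|]]]].
Qed.

(** Freezing a leaf removes an element of [A]; expanding it adds one leaf and one element of [A].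
    Doubling the deficit in leaves makes the measure drop in both cases while there are at most
    [i + j] leaves; beyond that, coefficient and count vanish. *)
Lemma count_grown (m : blossoming_map) (x0 : m) eps (A : {set m}) i j :
    labelled x0 -> four_valent m -> {subset A <= [set d | is_leaf d]} ->
  exists2 k : nat, k%:R = growth_series x0 eps A i j
    & counted (@over_iso m) (grown x0 eps A i j) k.
Proof.
have [n] := ubnP (((i + j).+1 - #|[set d : m | is_leaf d]|).*2 + #|A|)%N.
elim: n m x0 A => // n IHn m x0 A ltn lab_m m4 A_leaf.
have [->|/set0Pn[a aA]] := eqVneq A set0; first exact: count_grown0.
have [lt_ij|le_ij] := ltnP (i + j) #|[set d : m | is_leaf d]|.
  exists 0%N; first by rewrite (growth_series_ord x0 eps A lt_ij).
  apply: counted0 => X gX; have := grown_leaves lab_m m4 gX; lia.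
have leaf_a : is_leaf a by have := A_leaf a aA; rewrite inE.
have IHb b : exists2 k : nat, k%:R = growth_series (inl x0 : expand b leaf_a) eps (expand_active A leaf_a b) i j
    & counted (@over_iso (expand b leaf_a))
        (grown (inl x0 : expand b leaf_a) eps (expand_active A leaf_a b) i j) k.
  have [lab_e _] := expand_labelled_lab b leaf_a lab_m.
  apply: IHn => //; last first.
  - move=> [d|k]; rewrite !inE ?expand_leafl ?expand_leafr //.
    by case/andP=> /A_leaf + da; rewrite inE da.
  - exact: expand_four_valent.
  rewrite (card_expand_set leaf_a b (fun x => is_leaf (x : expand b leaf_a))).
  rewrite (card_expand_set leaf_a b (fun x : m + 'I_4 => match x with
    | inl d => (d \in A) && (d != a) | inr i => (i != 0) && (i != lift ord0 b) end)) /=.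
  rewrite (eq_card (B := [pred k : 'I_4 | (k != 0) && (k != lift ord0 b)])); last first.
    by move=> k; rewrite !inE expand_leafr.
  rewrite card_inr_leaves (eq_card (B := [set d | is_leaf d] :\ a)); last first.
    by move=> d; rewrite !inE expand_leafl.
  rewrite (eq_card (A := [pred d | (d \in A) && (d != a)]) (B := A :\ a)); last first.
    by move=> d; rewrite !inE andbC.
  move: ltn le_ij; rewrite (cardsD1 a A) aA (cardsD1 a [set d | is_leaf d]) inE leaf_a /=.
  by lia.
have [k0 k0E count0] : exists2 k : nat, k%:R = growth_series x0 eps (A :\ a) i j
    & counted (@over_iso m) (grown x0 eps (A :\ a) i j) k.
  apply: IHn => //; last by move=> d /setD1P[_ /A_leaf].
  by move: ltn; rewrite (cardsD1 a A) aA; lia.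
have [k1 k1E count1] := IHb 0; have [k2 k2E count2] := IHb 1; have [k3 k3E count3] := IHb 2%:R.
exists (k0 + (k1 + k2 + k3))%N.
  by rewrite (growth_seriesS eps lab_m leaf_a aA) !natrD k0E k1E k2E k3E.
pose Q b Y := exists2 X : map_over (expand b leaf_a),
  grown (inl x0 : expand b leaf_a) eps (expand_active A leaf_a b) i j X & Y = expand_over X.
have Q_neq b b' X Y : b != b' -> Q b X -> Q b' Y -> ~ over_iso X Y.
  by move=> neq [X' [emb_X _ _ _] ->] [Y' [emb_Y _ _ _] ->]; apply: expand_over_neq.
have gQ_neq b X Y : grown x0 eps (A :\ a) i j X -> Q b Y -> ~ over_iso X Y.
  move=> [_ st _ _] [Y' gY ->] [f iso_f fE].
  have [_] := expand_over_grown aA gY.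
  by rewrite -fE (iso_stem iso_f) st // !inE eqxx.
have [c1 c2 c3] := And3 (count_expand count1) (count_expand count2) (count_expand count3).
have cQ : counted (@over_iso m) (fun X => (Q 0 X \/ Q 1 X) \/ Q 2%:R X) (k1 + k2 + k3).
  apply: countedU (countedU _ _ c1 c2) c3 => [X Y|X Y|X Y|X Y].
  - by move=> [QX|QX] QY; [apply: (Q_neq 0 2%:R)|apply: (Q_neq 1 2%:R)].
  - by move=> [QX|QX] QY; [apply: (Q_neq 2%:R 0)|apply: (Q_neq 2%:R 1)].
  - by move=> QX QY; apply: (Q_neq 0 1).
  by move=> QX QY; apply: (Q_neq 1 0).
apply: counted_ext (countedU _ _ count0 cQ) => [X|X Y gX QY|X Y gX QY].
- rewrite (grown_split x0 eps leaf_a aA); split=> [[|[[]|]]|[|[b [Y [gY ->]]]]]; first by left.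
  + by move=> [Y gY ->]; right; exists 0, Y.
  + by move=> [Y gY ->]; right; exists 1, Y.
  + by move=> [Y gY ->]; right; exists 2%:R, Y.
  + by left.
  right; have QY : Q b (expand_over Y) by exists Y.
  have : b \in [:: 0; 1; 2%:R] by case: (b) => [[|[|[|]]]].
  by rewrite !inE => /or3P[]/eqP eb; rewrite eb in Y gY QY *; [left; left|left; right|right].
- by case: QY => [[|]|]; apply: gQ_neq.
move=> /over_iso_sym; by case: QY => [[|]|]; apply: gQ_neq.
Qed.

End Substitution.

(** * Leaves at scheme vertices *)

Lemma sum_porbits (T : finType) (s : {perm T}) (S : {set T}) :
  (\sum_(v in porbits s) #|v :&: S|)%N = #|S|.
Proof.
transitivity (\sum_(v in porbits s) \sum_(d in S) (d \in v : nat))%N.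
  apply: eq_bigr => v _; rewrite -sum1_card -big_mkcondr /=.
  by apply: eq_bigl => d; rewrite inE andbC.
rewrite exchange_big /= -sum1_card; apply: eq_bigr => d _.
rewrite (bigD1 (porbit s d)) ?imset_f //= porbit_id big1 // => _ /andP[/imsetP[e _ ->] neq].
by case: (boolP (d \in _)) => //; rewrite -eq_porbit_mem eq_sym => /eqP eq_p; rewrite eq_p eqxx in neq.
Qed.

Section SchemeLeaves.

Variables (c : blossoming_map) (x0 : c).
Hypothesis lab_c : labelled x0.
Hypothesis c4 : four_valent c.
Hypothesis core : forall v, v \in vertices c -> (2 <= interior_degree v)%N.
Hypothesis scheme_root : (3 <= interior_degree (vertex_of x0))%N.

Local Notation t := (findex (contour c) x0).

Lemma card_stems (v : {set c}) : v \in vertices c ->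
  (#|v :&: [set d | is_leaf d]| + #|v :&: bud c| + interior_degree v)%N = 4%N.
Proof.
move=> vv; have /forallP/(_ v) := c4; rewrite vv => /eqP <-.
rewrite /degree /interior_degree -[RHS](cardsID [set d | is_stem d]); congr (_ + _)%N; last first.
  by apply: eq_card => d; rewrite !inE andbC.
rewrite -[RHS](cardsID (bud c)) addnC; congr (_ + _)%N; apply: eq_card => d; rewrite !inE /is_leaf.
  by have [/bud_stem ->|] := boolP (d \in bud c); rewrite ?andbT ?andbF.
by rewrite andbA andbC.
Qed.

Section DegreeTwo.

Variables (v : {set c}).
Hypothesis vv : v \in vertices c.
Hypothesis v2 : interior_degree v = 2%N.

Lemma root_notin : x0 \notin v.
Proof.
apply/negP=> x0v; have /imsetP[d _ defv] := vv; rewrite defv -eq_porbit_mem in x0v.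
by move: scheme_root; rewrite /vertex_of (eqP x0v) -defv v2.
Qed.

Lemma vertex_iter (d : c) i : d \in v -> iter i (rot c) d \in v.
Proof.
have /imsetP[e _ ->] := vv; move=> de; elim: i => //= i; exact: vertex_of_rot.
Qed.

(** After traversing the edge towards [d] the contour follows [rot] as long as it meets stems, and
    the time never wraps because the root corner is not at [v]. *)
Lemma findex_rot (d : c) k : d \in v -> ~~ is_stem d -> (0 < k)%N ->
    (forall j, (0 < j < k)%N -> is_stem (iter j (rot c) d)) ->
  t (iter k (rot c) d) = (t (opp c d) + k)%N.
Proof.
move=> dv ds; have neq i : iter i (rot c) d != x0.
  by apply: contraNneq root_notin => <-; apply: vertex_iter.
elim: k => // -[_ _ _|k IHk _ st].
  rewrite addn1 /= -findex_contourS //; first by rewrite contourE oppK.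
  by have := neq 1%N; rewrite contourE oppK.
rewrite addnS -IHk // => [|j lt_j]; last by apply: st; lia.
have stk : is_stem (iter k.+1 (rot c) d) by apply: st; lia.
have cE : contour c (iter k.+1 (rot c) d) = iter k.+2 (rot c) d by rewrite contourE (eqP stk).
by rewrite -cE findex_contourS // cE.
Qed.

(* Between the crossing of the edge of [d] towards [v] and that of the next
   edge at [v], the contour meets only stems. *)
Lemma findex_gap (d e : c) k : d \in v -> ~~ is_stem d -> (0 < k)%N ->
    (forall j, (0 < j < k)%N -> is_stem (iter j (rot c) d)) ->
  ~~ is_stem e -> (t (opp c d) < t e)%N -> (t (opp c d) + k <= t e)%N.
Proof.
move=> dv ds k0 st es lt_e; rewrite leqNgt; apply/negP=> gt_e.
have [j defj] : exists j, t e = (t (opp c d) + j)%N by exists (t e - t (opp c d))%N; lia.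
have [t_inj _ _ _ _] := lab_c.
have ejd : e = iter j (rot c) d.
  apply: t_inj; rewrite findex_rot //; first lia.
  by move=> i lti; apply: st; lia.
by case/negP: es; rewrite ejd; apply: st; lia.
Qed.

(** The contour passes twice at [v], from the edge of [d1] to that of [d2] and back. Whichever
    passage comes first, one edge is first traversed towards [v] and the other away from it, so
    their label variations around [v] cancel, and those of the two stems must cancel too. *)
Lemma card_bud_degree2 : #|v :&: bud c| = 1%N.
Proof.
have /eqP/cards2P[d1 [d2 [neq12 defE]]] := v2.
have inE' z : (z \in v) && ~~ is_stem z = (z == d1) || (z == d2).
  by have := congr1 (fun A : {set c} => z \in A) defE; rewrite !inE.
have /andP[d1v d1s] : (d1 \in v) && ~~ is_stem d1 by rewrite inE' eqxx.
have /andP[d2v d2s] : (d2 \in v) && ~~ is_stem d2 by rewrite inE' eqxx orbT.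
have vertexE d : d \in v -> v = vertex_of d.
  by have /imsetP[e _ ->] := vv; move=> de; apply/eqP; rewrite eq_sym eq_porbit_mem.
have card_v : #|v| = 4%N by have /forallP/(_ v) := c4; rewrite vv => /eqP.
have next d e : d \in v -> e \in v -> d != e -> ~~ is_stem d -> ~~ is_stem e ->
    (forall z, z \in v -> ~~ is_stem z -> z = d \/ z = e) ->
  exists2 k, (0 < k)%N & t e = (t (opp c d) + k)%N /\
    forall z, ~~ is_stem z -> (t (opp c d) < t z)%N -> (t (opp c d) + k <= t z)%N.
  move=> dv ev neq ds es only.
  have un := uniq_traject_porbit (rot c) d; rewrite -/(vertex_of d) -vertexE // card_v in un.
  have : e \in traject (rot c) d 4.
    by have := ev; rewrite (vertexE d) // /vertex_of porbit_traject -/(vertex_of d) -vertexE // card_v.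
  case/trajectP=> k ltk defe; have k0 : (0 < k)%N.
    by case: k defe {ltk} => // defe; rewrite defe eqxx in neq.
  have st j : (0 < j < k)%N -> is_stem (iter j (rot c) d).
    move=> ltj; apply: contraT => /(only _ (vertex_iter j dv)) eqj.
    have it_inj i i' : (i < 4)%N -> (i' < 4)%N ->
        iter i (rot c) d = iter i' (rot c) d -> i = i'.
      move=> lti lti' eqi; apply/eqP; rewrite -(nth_uniq d _ _ un) ?size_traject //.
      by rewrite !nth_traject // eqi.
    have ltj4 : (j < 4)%N by case/andP: ltj => _ /ltn_trans; apply.
    case: eqj => eqj; first by move: ltj; rewrite (it_inj j 0%N ltj4 isT eqj).
    by move: ltj; rewrite (it_inj j k ltj4 ltk (etrans eqj defe)) ltnn andbF.
  exists k => //; split; first by rewrite defe findex_rot.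
  by move=> z zs; apply: findex_gap.
have only z : z \in v -> ~~ is_stem z -> z = d1 \/ z = d2.
  by move=> zv zs; have := inE' z; rewrite zv zs => /esym/orP[]/eqP; auto.
have [k k0 [tk gap]] := next d1 d2 d1v d2v neq12 d1s d2s only.
have neq21 : d2 != d1 by rewrite eq_sym.
have only' z : z \in v -> ~~ is_stem z -> z = d2 \/ z = d1 by move=> zv /(only z zv) [|]; auto.
have [k' k0' [tk' gap']] := next d2 d1 d2v d1v neq21 d2s d1s only'.
(* The variation of the label from the corner of [d] to that of [rot d]; it sums to 0 around the
   vertex. *)
pose sg d : int := if is_stem d then weight d else if (t d < t (opp c d))%N then -1 else 1.
have t_neq d e : d != e -> t d != t e.
  by have [t_inj _ _ _ _] := lab_c; apply: contra_neq => /t_inj.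
have sg12 : sg d1 + sg d2 = 0.
  rewrite /sg (negbTE d1s) (negbTE d2s).
  have := gap d1 d1s; have := gap' d2 d2s; have := t_neq _ _ neq12.
  have := t_neq d1 (opp c d1); have := t_neq d2 (opp c d2).
  rewrite eq_sym -/(is_stem d2) (eq_sym d1) -/(is_stem d1).
  by move=> /(_ d2s) n2 /(_ d1s) n1; do 2 case: ifP; lia.
have rot_v d : (rot c d \in v) = (d \in v).
  have /imsetP[e _ ->] := vv; rewrite -!eq_porbit_mem.
  by have := porbit_perm (rot c) 1 d; rewrite expg1 => ->.
have sum_sg : \sum_(d in v) sg d = 0.
  have : \sum_(d in v) lab x0 (rot c d) = \sum_(d in v) lab x0 d.
    rewrite [RHS](reindex_inj (@perm_inj _ (rot c))); apply: eq_bigl => d.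
    by rewrite rot_v.
  rewrite (eq_bigr (fun d => lab x0 d + sg d)).
    by rewrite big_split /= => e; apply: (addrI (\sum_(d in v) lab x0 d)); rewrite e addr0.
  move=> d dv; have neq : rot c d != x0 by apply: contraNneq root_notin => <-; rewrite rot_v.
  move: (neq); rewrite /sg rot_contour => /negbTE c0; rewrite labS // c0 addr0.
  have [sd|ds] := boolP (is_stem d); first by rewrite (eqP sd).
  by rewrite lab_opp // /weight nonstem_opp ds addr0.
have sum_w : \sum_(d in v) weight d = 0.
  have sgE : \sum_(d in v) sg d = sg d1 + sg d2 + \sum_(d in v) weight d.
    rewrite (bigD1 d1) // (bigD1 d2) /= ?d2v //.
    rewrite [X in _ = _ + X](bigD1 d1) //= [X in _ = _ + (_ + X)](bigD1 d2) /= ?d2v //.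
    have -> : weight d1 = 0 by rewrite /weight d1s.
    have -> : weight d2 = 0 by rewrite /weight d2s.
    rewrite !add0r addrA; congr (_ + _); apply: eq_bigr => d.
    case/andP=> /andP[dv n1] n2; rewrite /sg; case: ifP => // /negbT ds.
    by case: (only d dv ds) => eqd; [move: n1|move: n2]; rewrite eqd eqxx.
  by move: sum_sg; rewrite sgE sg12 add0r.
have := card_stems vv; rewrite v2; move: sum_w; rewrite sum_weight_set; lia.
Qed.

End DegreeTwo.

Lemma card_scheme_leaves g : has_genus c g ->
  (#|[set p : c | is_leaf p && (3 <= interior_degree (vertex_of p))%N]| + num_interior_degree4 c
   = 2 * g)%N.
Proof.
move=> genus_c; have uni := labelled_unicellular lab_c.
set SL := [set p | _].
have edgesE : (\sum_(v in vertices c) interior_degree v = 2 * #|edges c|)%N.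
  transitivity #|[set d : c | ~~ is_stem d]|.
    rewrite -(sum_porbits (rot c)); apply: eq_bigr => v _; apply: eq_card => d.
    by rewrite !inE.
  rewrite -(sum_porbits (opp c)) (bigID (fun e : {set c} => #|e| == 2%N)) /=.
  have orbE d : porbit (opp c) d = [set d; opp c d].
    apply/setP=> e; rewrite !inE; apply/porbitP/orP=> [[i ->]|[/eqP->|/eqP->]].
    - rewrite permX; elim: i => [|i]; first by left.
      by case=> /eqP /= ->; [right|left; rewrite oppK].
    - by exists 0%N; rewrite expg0 perm1.
    by exists 1%N; rewrite expg1.
  rewrite [X in (_ + X)%N]big1 => [|_ /andP[/imsetP[d _ ->]]]; last first.
    rewrite orbE cards2 => ne2; apply: eq_card0 => e; rewrite !inE.
    have st : is_stem d by rewrite /is_stem eq_sym; move: ne2; case: (d =P opp c d).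
    by rewrite (eqP st) orbb; case: eqP => // ->; rewrite st.
  rewrite addn0 (eq_bigr (fun=> 2%N)); last first.
    move=> _ /andP[/imsetP[d _ ->]]; rewrite orbE cards2 => ne2.
    have ds : ~~ is_stem d by rewrite /is_stem eq_sym; move: ne2; case: (d =P opp c d).
    rewrite (_ : _ :&: _ = [set d; opp c d]) ?cards2; first by apply/eqP.
    apply/setIidPl/subsetP=> e; rewrite !inE => /orP[]/eqP->//.
    by rewrite nonstem_opp.
  by rewrite sum_nat_const mulnC; congr (_ * _)%N; apply: eq_card => e; rewrite !inE.
(* A linear relation chosen so that its sum over the vertices, combined with the two leaves in
   excess and with Euler's formula for one face, is twice the claim. Degrees 3 and 4 follow by
   counting stems; degree 2 uses its single bud. *)
have local v : v \in vertices c ->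
    (#|v :&: SL| + #|v :&: SL| + #|v :&: bud c| + ((interior_degree v == 4%N) + (interior_degree v == 4%N)) + 2
     = #|v :&: [set d | is_leaf d]| + interior_degree v)%N.
  move=> vv; have cs := card_stems vv; have ge2 := core vv.
  have SLE : #|v :&: SL| = if (3 <= interior_degree v)%N then #|v :&: [set d | is_leaf d]| else 0%N.
    have vE d : d \in v -> vertex_of d = v.
      by have /imsetP[e _ ->] := vv; move=> de; apply/eqP; rewrite eq_porbit_mem.
    case: ifP => deg3; last apply: eq_card0 => d; last rewrite !inE.
      apply: eq_card => d; rewrite !inE; have [dv|//] := boolP (d \in v).
      by rewrite (vE d dv) deg3 andbT.
    by have [dv|//] := boolP (d \in v); rewrite (vE d dv) deg3 andbF.
  rewrite SLE; case: ifP => deg3; first by case: eqP; lia.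
  have v2 : interior_degree v = 2%N by lia.
  by have := card_bud_degree2 vv v2; rewrite v2 in cs *; lia.
have : (\sum_(v in vertices c)
      (#|v :&: SL| + #|v :&: SL| + #|v :&: bud c| + ((interior_degree v == 4%N) + (interior_degree v == 4%N)) + 2)
    = \sum_(v in vertices c) (#|v :&: [set d | is_leaf d]| + interior_degree v))%N.
  exact: eq_bigr.
rewrite !big_split /= /= !sum_porbits edgesE.
rewrite (card_leaf_bud lab_c) sum_nat_const -/(vertices c).
have -> : (\sum_(v in vertices c) (interior_degree v == 4%N) = num_interior_degree4 c)%N.
  rewrite /num_interior_degree4 -sum1_card -big_mkcondr /=.
  by apply: eq_bigl => v; rewrite inE.
move: genus_c uni; rewrite /has_genus /unicellular => genus_c /eqP uni; rewrite uni in genus_c.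
move: genus_c; rewrite mul2n -addnn [(#|edges c| + _)%N]addnC.
by move: #|SL| #|bud c| #|vertices c| #|edges c| (num_interior_degree4 c) => sl b nv ne n4; lia.
Qed.

End SchemeLeaves.

(** * Automorphisms of the core *)

Lemma is_rooted_iso_inv (o o' : rooted_map) (f : o -> o') (g : o' -> o) :
  is_rooted_iso f -> cancel f g -> cancel g f -> is_rooted_iso g.
Proof.
move=> [fb [fr fo] fbud ft f_root] fK gK; split.
- by exists f.
- by split=> y; apply: (canLR fK); rewrite ?fr ?fo gK.
- by move=> y; rewrite -fbud gK.
- by move=> y; rewrite -ft gK.
by apply: (canLR fK).
Qed.

Lemma is_rooted_iso_comp (o1 o2 o3 : rooted_map) (g : o2 -> o3) (f : o1 -> o2) :
  is_rooted_iso g -> is_rooted_iso f -> is_rooted_iso (g \o f).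
Proof.
move=> [gb [gr go] gbud gt g_root] [fb [fr fo] fbud ft f_root]; split.
- exact: bij_comp.
- by split=> d; rewrite /= ?fr ?fo ?gr ?go.
- by move=> d; rewrite /= gbud fbud.
- by move=> d; rewrite /= gt ft.
by rewrite /= f_root g_root.
Qed.

Lemma is_rooted_iso_id o : @is_rooted_iso o o id.
Proof. by split=> //; exists id. Qed.

Lemma rooted_iso_rigid (o : rooted_map) (f : o -> o) : is_rooted_iso f -> f =1 id.
Proof.
move=> [_ [fr fo] _ _ f_root] d.
have /connectP[p] := map_connected (root o) d.
elim: p (root o) f_root => [x fx _ -> //|y p IHp x fx /= /andP[/orP[]/eqP-> pp]]; apply: IHp => //.
  by rewrite fr fx.
by rewrite fo fx.
Qed.

Lemma rooted_iso_sym o o' : rooted_iso o o' -> rooted_iso o' o.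
Proof.
case=> f iso_f; have [[g fK gK] _ _ _ _] := iso_f.
by exists g; apply: is_rooted_iso_inv iso_f fK gK.
Qed.

Lemma rooted_iso_trans o1 o2 o3 : rooted_iso o1 o2 -> rooted_iso o2 o3 -> rooted_iso o1 o3.
Proof. by move=> [f iso_f] [g iso_g]; exists (g \o f); apply: is_rooted_iso_comp. Qed.

Record rooted_over (c : blossoming_map) :=
  RootedOver { rover_map :> rooted_map; rover_emb : c -> rover_map }.

Definition rover_iso (c : blossoming_map) (X Y : rooted_over c) : Prop :=
  exists2 f : X -> Y, is_rooted_iso f & forall d, f (rover_emb X d) = rover_emb Y d.

Lemma rover_iso_sym c (X Y : rooted_over c) : rover_iso X Y -> rover_iso Y X.
Proof.
move=> [f iso_f fE]; have [[g fK gK] _ _ _ _] := iso_f.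
by exists g => [|d]; [apply: is_rooted_iso_inv iso_f fK gK|rewrite -fE fK].
Qed.

Lemma rover_iso_trans c (X Y Z : rooted_over c) :
  rover_iso X Y -> rover_iso Y Z -> rover_iso X Z.
Proof.
move=> [f iso_f fE] [g iso_g gE]; exists (g \o f); first exact: is_rooted_iso_comp.
by move=> d; rewrite /= fE gE.
Qed.

Definition automorphisms (c : blossoming_map) : {set {ffun c -> c}} :=
  [set phi : {ffun c -> c} | `[< is_iso phi >]].

Lemma card_automorphisms_gt0 c : (0 < #|automorphisms c|)%N.
Proof.
apply/card_gt0P; exists [ffun d => d]; rewrite inE; apply/asboolP; split.
- by exists id => d; rewrite ffunE.
- by move=> d; rewrite !ffunE.
- by move=> d; rewrite !ffunE.
by move=> d; rewrite ffunE.
Qed.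

(* Rooted maps are rigid, so the automorphisms of [c] act freely on the pairs
   made of a rooted map and an embedding of [c] into it. *)
Lemma counted_quotient (c : blossoming_map) (P : rooted_map -> Prop)
    (E : forall o : rooted_map, (c -> o) -> Prop) (n : nat) :
    (forall o e (phi : c -> c), E o e -> is_iso phi -> E o (fun d => e (phi d))) ->
    (forall o e e', E o e -> E o e' -> exists2 phi : c -> c, is_iso phi & forall d, e' d = e (phi d)) ->
    (forall (o o' : rooted_map) (f : o -> o') e, is_rooted_iso f -> E o e -> E o' (fun d => f (e d))) ->
    (forall o e, E o e -> injective e) ->
    (forall o, P o -> exists e, E o e) ->
    counted (@rover_iso c) (fun X => P X /\ E X (rover_emb X)) n ->
  exists2 k, n = (k * #|automorphisms c|)%N & counted rooted_iso P k.
Proof.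
move=> E_aut E_trans E_iso E_inj P_E [s [sP sR sall]].
pose rel i j := `[< rooted_iso (s i) (s j) >].
have rel_equiv : {in [set: 'I_n] & &, equivalence_rel rel}.
  move=> i j k _ _ _; split; first by apply/asboolP; exists id; apply: is_rooted_iso_id.
  move=> /asboolP ij; apply/asboolP/asboolP; last exact: rooted_iso_trans.
  by apply: rooted_iso_trans; apply: rooted_iso_sym.
have part := equivalence_partitionP rel_equiv.
set classes := equivalence_partition rel [set: 'I_n] in part.
(* Composing the embedding of [s i] with an automorphism leads to an index of the same class.
   Rigidity makes this injective, and the whole class is reached since embeddings into one map
   differ by automorphisms. *)
have class_card : {in classes, forall B : {set 'I_n}, #|B| = #|automorphisms c|}.
  move=> _ /imsetP[i _ ->].
  pose X (phi : {ffun c -> c}) := RootedOver (fun d : c => rover_emb (s i) (phi d)).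
  have [Pi Ei] := sP i.
  have G_ex (phi : {ffun c -> c}) : exists j, phi \in automorphisms c -> rover_iso (s j) (X phi).
    have [|] := boolP (phi \in automorphisms c); last by exists i.
    rewrite inE => /asboolP iso_phi; have [j sj] : exists j, rover_iso (s j) (X phi).
      by apply: sall; split=> //; apply: E_aut.
    by exists j.
  pose G phi := sval (cid (G_ex phi)).
  have GP phi : phi \in automorphisms c -> rover_iso (s (G phi)) (X phi).
    by rewrite /G; case: (cid _).
  rewrite -(card_in_imset (f := G) (D := automorphisms c)); last first.
    move=> phi psi phiA psiA eqG; have := GP _ phiA; rewrite eqG => /rover_iso_sym sphi.
    have [f iso_f fE] := rover_iso_trans sphi (GP _ psiA).
    apply/ffunP=> d; apply: (E_inj _ _ Ei).
    by have := fE d; rewrite (rooted_iso_rigid iso_f).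
  apply: eq_card => j; rewrite inE in_setT /=; apply/asboolP/imsetP => [[f iso_f]|[phi phiA ->]].
    have [Pj Ej] := sP j; have [[g fK gK] _ _ _ _] := iso_f.
    have Eg := E_iso _ _ g _ (is_rooted_iso_inv iso_f fK gK) Ej.
    have [phi iso_phi phiE] := E_trans _ _ _ Ei Eg.
    have phiA : [ffun d => phi d] \in automorphisms c.
      rewrite inE; apply/asboolP; have [pb pr po pbud] := iso_phi; split.
      - by apply: (eq_bij pb) => d; rewrite ffunE.
      - by move=> d; rewrite !ffunE.
      - by move=> d; rewrite !ffunE.
      by move=> d; rewrite ffunE.
    exists [ffun d => phi d] => //; apply/esym/sR; apply: rover_iso_trans (GP _ phiA) _.
    by exists f => // d; rewrite /= ffunE -phiE gK.
  have [f iso_f _] := rover_iso_sym (GP _ phiA); by exists f.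
exists #|classes|; first by rewrite -(card_uniform_partition class_card part) cardsT card_ord.
have rep_ex (t : 'I_#|classes|) : exists i, enum_val t = [set j in [set: 'I_n] | rel i j].
  by have /imsetP[i _ ->] := enum_valP t; exists i.
pose rep t := sval (cid (rep_ex t)).
have repE t : enum_val t = [set j in [set: 'I_n] | rel (rep t) j] by rewrite /rep; case: cid.
exists (fun t => rover_map (s (rep t))); split.
- by move=> t; case: (sP (rep t)).
- move=> t t' /asboolP rr; apply: enum_val_inj; rewrite !repE; apply/setP=> j.
  rewrite !inE /=; have [_] := rel_equiv (rep t) (rep t') j (in_setT _) (in_setT _) (in_setT _).
  by apply.
move=> o Po; have [e Ee] := P_E o Po.
have [i [f iso_f _]] := sall (RootedOver e) (conj Po Ee).
have cl_i : [set j in [set: 'I_n] | rel i j] \in classes by apply: imset_f.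
pose t := enum_rank_in cl_i [set j in [set: 'I_n] | rel i j].
have tE : enum_val t = [set j in [set: 'I_n] | rel i j] by rewrite enum_rankK_in.
exists t; apply: rooted_iso_trans (_ : rooted_iso _ (s i)) _; last by exists f.
apply/asboolP; rewrite -/(rel _ _).
have : i \in enum_val t by rewrite tE !inE /=; apply/asboolP; exists id; apply: is_rooted_iso_id.
by rewrite repE !inE.
Qed.

Lemma map_iso_refl m : map_iso m m.
Proof. by exists id; split=> //; exists id. Qed.

Lemma reroot_unroot (u : blossoming_map) (s : u) (leaf_s : is_leaf s) (lab_s : labelled s) :
  @is_iso (unroot (reroot leaf_s lab_s)) u id.
Proof. by apply: iso_inv (unroot_reroot leaf_s lab_s) _ _. Qed.

Lemma iso_good_leaf (m m' : blossoming_map) (f : m -> m') (s : m) :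
  is_iso f -> labelled s -> good_leaf s -> good_leaf (f s).
Proof.
move=> iso_f lab_s [leaf_s ge2]; have [_ labE] := iso_labelled iso_f lab_s.
split=> [|d]; first by rewrite (iso_leaf iso_f).
by have [[g fK gK] _ _ _] := iso_f; rewrite -(gK d) labE.
Qed.

(** * Good maps and rooted cores with a prescribed unrooted core *)

Section UnrootedCore.

Variables (c : blossoming_map) (x0 : c).
Hypothesis lab_c : labelled x0.

Section GoodMaps.

Hypothesis c4 : four_valent c.
Hypothesis core : forall v, v \in vertices c -> (2 <= interior_degree v)%N.
Variables i j : nat.

Definition good_over (o : rooted_map) : Prop :=
  [/\ good_map o /\ has_unrooted_core o c, (black_leaves o).+1 = i & white_leaves o = j].

(** A map grown from [c] has two good leaves; [eps] tells, by parity from the base [x0], which one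
    is the root. *)
Definition good_pair (eps : bool) (X : rooted_over c) : Prop :=
  [/\ good_over X, @embedding c (unroot X) (rover_emb X)
    & odd (absz (@lab (unroot X) (rover_emb X x0) (root X))) = eps].

Definition unroot_over (X : rooted_over c) : map_over c :=
  @MapOver c (unroot X) (rover_emb X).

Lemma good_pair_labelled eps X : good_pair eps X ->
  [/\ @labelled (unroot X) (unroot_root X), @labelled (unroot X) (rover_emb X x0),
      well_oriented X & @good_leaf (unroot X) (unroot_root X)].
Proof.
move=> [[[/good_mapE[_ lab_X wo gl] _] _ _] _ _]; split=> //.
by have [] := labelled_change_base (rover_emb X x0 : unroot X) lab_X.
Qed.

(** An isomorphism fixing the copy of [c] preserves labels based at [x0], hence sends the root to
    the unique good leaf of the same parity. *)
Lemma good_pair_iso eps X Y : good_pair eps X -> good_pair eps Y ->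
  over_iso (unroot_over X) (unroot_over Y) <-> rover_iso X Y.
Proof.
move=> gX gY; have [lab_X lab_eX woX glX] := good_pair_labelled gX.
have [lab_Y lab_eY woY glY] := good_pair_labelled gY.
split=> [[f iso_f fE]|[f iso_f fE]]; last by exists f => //; apply: rooted_iso_is_iso.
exists f => //; apply: unroot_rooted_iso => //.
apply: (good_leaf_unique lab_eY) => //; first exact: iso_good_leaf iso_f lab_X glX.
have [_ labE] := iso_labelled iso_f lab_eX.
have fE0 : f (rover_emb X x0) = rover_emb Y x0 := fE x0.
rewrite fE0 in labE; rewrite labE.
by case: gX gY => _ _ pX [_ _ pY]; apply: etrans pX (esym pY).
Qed.

Lemma good_pair_grown eps X : good_pair eps X ->
  grown x0 eps [set d | is_leaf d] i j (unroot_over X).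
Proof.
move=> gX; have [lab_X lab_eX woX _] := good_pair_labelled gX.
case: gX => [[[/good_mapE[_ _ _ _] _] bl wh] emb_X parX].
have [blE whE] := black_white_leaves lab_X (labelled_well_labeled lab_X woX).
rewrite !(colored_leaves_base (unroot_root X) _ lab_eX) [odd _]parX in blE whE.
by split=> //=; [move=> d ld; rewrite inE ld|rewrite -bl blE|rewrite -wh whE].
Qed.

(** The root is the good leaf of parity [eps]; basing labels there exchanges the colours exactly
    when [eps] is true. *)
Lemma grown_good_pair eps (Y : map_over c) : grown x0 eps [set d | is_leaf d] i j Y ->
  exists2 X, good_pair eps X & over_iso (unroot_over X) Y.
Proof.
move=> [emb_Y _ ci cj]; have [lab_eY Y4 prune_Y] := embedding_grow emb_Y lab_c c4.
have [s gl_s par_s] := good_leaf_exists lab_eY eps.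
have [lab_s _] := labelled_change_base s lab_eY; have [leaf_s _] := gl_s.
have iso_r := unroot_reroot leaf_s lab_s.
set o := reroot leaf_s lab_s in iso_r.
have [lab_o labE] := iso_labelled iso_r lab_s.
have [lab_eo labeE] := iso_labelled iso_r lab_eY.
have wo_o : well_oriented o := @reroot_well_oriented _ _ leaf_s lab_s.
have [blE whE] := black_white_leaves (o := o) lab_o (labelled_well_labeled lab_o wo_o).
have par_o : odd (absz (@lab (unroot o) (over_emb Y x0) (unroot_root o))) = eps.
  by rewrite -par_s; have := labeE s; rewrite /= => <-.
rewrite !(colored_leaves_base (unroot_root o) _ lab_eo) par_o in blE whE.
rewrite !(iso_colored_leaves _ iso_r lab_eY) /= ci in blE.
rewrite !(iso_colored_leaves _ iso_r lab_eY) /= cj in whE.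
exists (@RootedOver c o (over_emb Y)); last first.
  by exists id => //; apply: reroot_unroot.
split=> //; last exact: iso_comp_embedding emb_Y iso_r.
split=> //; split; last first.
  apply: pruned_to_iso (prune_Y c _) _; last by exists id.
  apply: PrunedDone (map_iso_refl c) => v vv deg1.
  by have := core vv; rewrite deg1.
apply/good_mapE; split=> //; exact: iso_good_leaf iso_r lab_s gl_s.
Qed.

Lemma count_good_pairs (Tb Tw : series2) : T_system Tb Tw ->
  exists2 n : nat, n%:R = growth_series Tb Tw x0 false [set d | is_leaf d] i j
      + growth_series Tb Tw x0 true [set d | is_leaf d] i j
    & counted (@rover_iso c)
        (fun X => good_over X /\ @embedding c (unroot X) (rover_emb X)) n.
Proof.
move=> T_sys.
have count eps : exists2 n : nat,
    n%:R = growth_series Tb Tw x0 eps [set d | is_leaf d] i j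
    & counted (@rover_iso c) (good_pair eps) n.
  have [n nE cn] := count_grown T_sys eps i j lab_c c4 (fun d dl => dl).
  exists n => //; apply: counted_preimage cn; last exact: grown_good_pair.
  - exact: over_iso_sym.
  - exact: over_iso_trans.
  - exact: good_pair_grown.
  exact: good_pair_iso.
have [n0 n0E c0] := count false; have [n1 n1E c1] := count true.
exists (n0 + n1)%N; first by rewrite natrD n0E n1E.
have neq X Y : good_pair false X -> good_pair true Y -> ~ rover_iso X Y.
  move=> gX gY [f iso_f fE]; have [_ lab_eX _ _] := good_pair_labelled gX.
  have [_ labE] := iso_labelled (rooted_iso_is_iso iso_f) lab_eX.
  case: gX gY => [_ _ pX] [_ _]; have [_ _ _ _ <-] := iso_f.
  by rewrite -fE labE pX.
apply: counted_ext (countedU _ _ c0 c1) => // [X|X Y gX gY /rover_iso_sym]; last exact: neq.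
split=> [[[gX eX _]|[gX eX _]] //|[gX eX]].
by case par: (odd (absz (@lab (unroot X) (rover_emb X x0) (root X)))); [right|left].
Qed.

Lemma count_good (Tb Tw : series2) : T_system Tb Tw ->
  exists2 k : nat, (k * #|automorphisms c|)%:R =
      growth_series Tb Tw x0 false [set d | is_leaf d] i j
      + growth_series Tb Tw x0 true [set d | is_leaf d] i j
    & counted rooted_iso good_over k.
Proof.
move=> T_sys; have [n <- cn] := count_good_pairs T_sys.
have [|||||k -> ck] := @counted_quotient c good_over
  (fun o e => @embedding c (unroot o) e) n _ _ _ _ _ cn; last by exists k.
- by move=> o e phi; apply: embedding_comp_iso.
- by move=> o e e'; apply: embedding_unique.
- by move=> o o' f e /rooted_iso_is_iso iso_f emb_e; apply: iso_comp_embedding iso_f.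
- by move=> o e [].
move=> o [[/good_mapE[o4 lab_o _ _] prune_o] _ _].
by have [_] := pruned_embedding prune_o x0; move=> /(_ _ lab_o o4).
Qed.

End GoodMaps.

Section Cores.

Hypothesis c4 : four_valent c.
Hypothesis core : forall v, v \in vertices c -> (2 <= interior_degree v)%N.
Variables i j : nat.

Definition scheme_leaves : {set c} :=
  [set p | is_leaf p && (3 <= interior_degree (vertex_of p))%N].

Definition core_over (o : rooted_map) : Prop :=
  [/\ in_R o /\ map_iso (unroot o) c, (black_leaves o).+1 = i & white_leaves o = j].

Definition weighted_leaves : {set c} :=
  [set p in scheme_leaves | (colored_leaves p false == i) && (colored_leaves p true == j)].

(** Rerooting [c] at a leaf, with the identity as marking, is inverse to reading the root of a core
    through its isomorphism with [c]. *)
Lemma count_core_pairs : counted (@rover_iso c)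
  (fun X => core_over X /\ @is_iso c (unroot X) (rover_emb X)) #|weighted_leaves|.
Proof.
have leafP (p : {p | p \in weighted_leaves}) : is_leaf (val p).
  by have := valP p; rewrite !inE => /andP[/andP[]].
have labP (p : c) : labelled p by case: (labelled_change_base p lab_c).
rewrite -[#|weighted_leaves|]card_sig.
apply: (@counted_fin _ _ _ _ (fun p : {p | p \in weighted_leaves} =>
  @RootedOver c (reroot (leafP p) (labP (val p))) id)).
- move=> p; have iso_r := unroot_reroot (leafP p) (labP (val p)); split; last exact: iso_r.
  set o := reroot _ _ in iso_r.
  have [lab_o _] := iso_labelled iso_r (labP (val p)).
  have wo_o : well_oriented o := @reroot_well_oriented _ _ (leafP p) (labP (val p)).
  have [blE whE] := black_white_leaves (o := o) lab_o (labelled_well_labeled lab_o wo_o).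
  have := valP p; rewrite !inE => /andP[/andP[_ deg3] /andP[/eqP ci /eqP cj]].
  rewrite (iso_colored_leaves _ iso_r (labP (val p))) in blE.
  rewrite (iso_colored_leaves _ iso_r (labP (val p))) in whE.
  split; [split|exact: etrans blE ci|exact: etrans whE cj]; first exact/in_RE.
  by apply: map_iso_sym; exists id.
- move=> p q [f iso_f fE]; apply: val_inj; have [_ _ _ _ f_root] := iso_f.
  by rewrite -[val p](fE (val p)); apply: f_root.
move=> X [[[/in_RE[X4 lab_X woX coreX deg3] _] blX whX] iso_e].
have [[g eK gK] _ _ _] := iso_e; pose p := g (unroot_root X).
have ep : rover_emb X p = unroot_root X by apply: gK.
have [blE whE] := black_white_leaves lab_X (labelled_well_labeled lab_X woX).
have pS : p \in weighted_leaves.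
  rewrite !inE -(iso_leaf iso_e) ep unroot_root_leaf -(iso_interior_degree iso_e).
  rewrite -(iso_vertex iso_e) ep deg3 -!(iso_colored_leaves _ iso_e (labP p)) ep.
  by rewrite -blE -whE blX whX !eqxx.
exists (exist _ p pS); exists (rover_emb X) => //.
apply: unroot_rooted_iso => //; first exact: reroot_well_oriented.
exact: is_iso_comp iso_e (reroot_unroot _ _).
Qed.

Lemma count_cores : exists2 k : nat, #|weighted_leaves| = (k * #|automorphisms c|)%N
  & counted rooted_iso core_over k.
Proof.
have := @counted_quotient c core_over (fun o e => @is_iso c (unroot o) e) #|weighted_leaves|.
apply=> //; last exact: count_core_pairs.
- by move=> o e phi iso_e; apply: is_iso_comp iso_e.
- move=> o e e' iso_e iso_e'.
  exact: (embedding_unique core (iso_embedding iso_e) (iso_embedding iso_e')).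
- by move=> o o' f e /rooted_iso_is_iso iso_f iso_e; apply: is_iso_comp iso_f iso_e.
- by move=> o e /iso_inj.
by move=> o [[_ /map_iso_sym[e iso_e]] _ _]; exists e.
Qed.

End Cores.

(** * Substitution of the tree series *)

Section Series.

Variables (Tb Tw : series2).
Hypothesis T_sys : T_system Tb Tw.

Lemma growth_seriesE eps : growth_series Tb Tw x0 eps [set d | is_leaf d] =
  series_mul (series_exp Tb (colored_leaves x0 eps)) (series_exp Tw (colored_leaves x0 (~~ eps))).
Proof.
rewrite /growth_series; under eq_bigr => d ld do rewrite inE ld.
rewrite (bigID (color x0 eps)) /= series_mulC; congr series_mul.
  rewrite (eq_bigr (fun=> Tb)) => [|d /andP[_ /negbTE ->]] //.
  rewrite big_const; congr (iter _ _ _); apply: eq_card => d; rewrite !inE unfold_in /color.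
  by case: (odd _); case: eps.
rewrite (eq_bigr (fun=> Tw)) => [|d /andP[_ ->]] //.
rewrite big_const; congr (iter _ _ _); apply: eq_card => d; rewrite !inE unfold_in /color.
by case: (odd _); case: eps.
Qed.

Lemma series_exp_ord (F : series2) n : F 0%N 0%N = 0 -> series_ord_ge n (series_exp F n).
Proof.
move=> F0; elim: n => [|n IHn]; first by move=> i j; rewrite ltn0.
by apply: (series_ord_geM (n := 1)) => // -[|i] [|j].
Qed.

Lemma subst_monomial (F G : series2) a b i j : F 0%N 0%N = 0 -> G 0%N 0%N = 0 ->
  series_subst (monomial a b) F G i j = series_mul (series_exp F a) (series_exp G b) i j.
Proof.
move=> F0 G0; rewrite /series_subst /monomial.
have [lt_ij|le_ab] := ltnP (i + j) (a + b).
  have ord := series_ord_geM (series_exp_ord (n := a) F0) (series_exp_ord (n := b) G0).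
  rewrite ord // big1 // => k _; rewrite big1 // => l _.
  by case: eqP => [->|_]; case: eqP => [->|_]; rewrite ?mul0r // ord ?mulr0.
have lta : (a < (i + j).+1)%N by lia.
have ltb : (b < (i + j).+1)%N by lia.
rewrite (bigD1 (Ordinal lta)) //= (bigD1 (Ordinal ltb)) //= !eqxx mul1r.
rewrite big1 ?addr0 => [|l neq]; last first.
  by rewrite -[(l : nat) == b]/(l == Ordinal ltb) (negbTE neq) mul0r.
rewrite big1 ?addr0 // => k neq; rewrite big1 // => l _.
by rewrite -[(k : nat) == a]/(k == Ordinal lta) (negbTE neq) mul0r.
Qed.

Definition core_series : series2 := fun i j => #|weighted_leaves i j|%:R / #|automorphisms c|%:R.

Lemma core_seriesE i j : core_series i j = \sum_(p in scheme_leaves)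
  monomial (colored_leaves p false) (colored_leaves p true) i j / #|automorphisms c|%:R.
Proof.
rewrite -mulr_suml; congr (_ / _).
rewrite -sum1_card natr_sum (eq_bigl (fun p => (p \in scheme_leaves) &&
  ((colored_leaves p false == i) && (colored_leaves p true == j)))); last first.
  by move=> p; rewrite !inE.
rewrite big_mkcondr; apply: eq_bigr => p _; rewrite /monomial (eq_sym i) (eq_sym j).
by case: (_ && _).
Qed.

Lemma core_series_subst (F G : series2) i j : F 0%N 0%N = 0 -> G 0%N 0%N = 0 ->
  series_subst core_series F G i j = \sum_(p in scheme_leaves)
    series_mul (series_exp F (colored_leaves p false)) (series_exp G (colored_leaves p true)) i j
    / #|automorphisms c|%:R.
Proof.
move=> F0 G0; rewrite /series_subst.
under eq_bigr => k _ do under eq_bigr => l _ do rewrite core_seriesE mulr_suml.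
under eq_bigr => k _ do rewrite exchange_big.
rewrite exchange_big; apply: eq_bigr => p _ /=.
rewrite -(subst_monomial _ _ _ _ F0 G0) /series_subst mulr_suml; apply: eq_bigr => k _.
by rewrite mulr_suml; apply: eq_bigr => l _; rewrite mulrAC.
Qed.

(** Every leaf [p] contributes the same amount: basing labels at [p] keeps or exchanges the two
    colour counts, and the sum of both substitutions does not see the exchange. *)
Lemma core_series_sum i j :
  series_subst core_series Tb Tw i j + series_subst core_series Tw Tb i j =
  #|scheme_leaves|%:R * ((growth_series Tb Tw x0 false [set d | is_leaf d] i j
    + growth_series Tb Tw x0 true [set d | is_leaf d] i j) / #|automorphisms c|%:R).
Proof.
have [b0 w0 _ _] := T_sys; rewrite !core_series_subst // -big_split /=.
rewrite (eq_bigr (fun=> (growth_series Tb Tw x0 false [set d | is_leaf d] i j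
    + growth_series Tb Tw x0 true [set d | is_leaf d] i j) / #|automorphisms c|%:R)).
  by rewrite sumr_const mulr_natl.
move=> p _; rewrite -mulrDl; congr (_ / _).
rewrite !(colored_leaves_base p _ lab_c) !growth_seriesE.
rewrite [series_mul (series_exp Tw _) (series_exp Tb _)]series_mulC.
by case: (odd _) => //=; rewrite addrC.
Qed.

End Series.

End UnrootedCore.

Theorem theorem3p14 (r : rooted_map) (g : nat) (Tb Tw : series2) :
  in_R r -> has_genus r g -> T_system Tb Tw ->
  exists Rr Or : series2,
    [/\ is_generating_series (fun r' => in_R r' /\ same_unrooted_core r' r) Rr,
        is_generating_series
          (fun o => good_map o /\ has_unrooted_core o (unroot r)) Or
      & forall i j, Or i j
          = (series_subst Rr Tb Tw i j + series_subst Rr Tw Tb i j)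
            / ((2 * g)%:R - (num_interior_degree4 r)%:R)].
Proof.
move=> /in_RE[r4 lab_r wo_r core_r deg3] genus_r T_sys.
have A_neq0 : #|automorphisms (unroot r)|%:R != 0 :> rat.
  by rewrite pnatr_eq0 -lt0n card_automorphisms_gt0.
have card_SL := card_scheme_leaves lab_r r4 core_r deg3 genus_r.
pose x0 := unroot_root r.
exists (core_series (unroot r)), (fun i j =>
  (growth_series Tb Tw x0 false [set d | is_leaf d] i j
   + growth_series Tb Tw x0 true [set d | is_leaf d] i j) / #|automorphisms (unroot r)|%:R).
split=> [i j|i j|i j].
- have [k kE ck] := count_cores lab_r r4 core_r i j; exists k; last exact: ck.
  by rewrite /core_series kE natrM mulfK.
- have [k kE ck] := count_good lab_r r4 core_r i j T_sys; exists k; last exact: ck.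
  by rewrite -kE natrM mulfK.
rewrite (core_series_sum lab_r T_sys).
have -> : (2 * g)%:R - (num_interior_degree4 r)%:R = #|scheme_leaves (unroot r)|%:R :> rat.
  by rewrite -card_SL natrD addrK.
(* The denominator is nonzero because the former root of [r] is itself a leaf at a scheme vertex. *)
rewrite [RHS]mulrAC mulfV ?mul1r // pnatr_eq0 -lt0n; apply/card_gt0P; exists x0.
by rewrite inE unroot_root_leaf.
Qed.
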